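(* Each quantization morphism $\underline{Q}:\underline{\mathrm{QUE}}\to\underline{\mathrm{UE}}_{\mathrm{cP}}[[\hbar]]$ is an isomorphism of props. Consequently the set of all quantization morphisms is a torsor over the groups $\mathrm{Aut}_1(\underline{\mathrm{QUE}})$, acting on the right, and $\mathrm{Aut}_1(\underline{\mathrm{UE}}_{\mathrm{cP}}[[\hbar]])$, acting on the left (both by composition).
   Context: Conventions. $\mathbb{K}$ is a field of characteristic zero, $\hbar$ a formal variable, $R$ is $\mathbb{K}$ or $\mathbb{K}[[\hbar]]$. All $\mathbb{K}[[\hbar]]$-modules are quotients of topologically free modules by closed submodules; direct sums and tensor products are taken in this (completed) category and maps are continuous. A prop $\underline{P}$ over $R$ is the collection of $R$-modules $\underline{P}(n,m)=\mathrm{Hom}(O^{\otimes n},O^{\otimes m})$ of a strict symmetric monoidal $R$-linear category with objects $O^{\otimes n}$, $n\ge0$, with composition $\circ$, tensor product $\otimes$ and maps $\mathbb{Q}\mathfrak{S}_n\to\underline P(n,n)$; elements of $\underline P(n,m)$ have bidegree $(n,m)$ ($n$ inputs, $m$ outputs). $(i_1\ldots i_k)$ is the permutation $a\mapsto i_a$ (moving factor $a$ to position $i_a$). $\underline P[[\hbar]](p,q)=\underline P(p,q)[[\hbar]]$; the torsion ideal of a prop over $\mathbb{K}[[\hbar]]$ is the collection of torsion submodules; $\underline P\langle x_i\rangle/(\text{relations})$ is obtained by adjoining generators and relations. The completion of $\underline P$ with respect to a decreasing family of ideals $I_n$ is $\varprojlim_n\underline P(p,q)/I_n(p,q)$. $\underline{\mathrm{Bialg}}$: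 prop over $\mathbb{K}$ with generators $m,\Delta,\eta,\epsilon$ of bidegrees $(2,1),(1,2),(0,1),(1,0)$ and the bialgebra relations: $m$ associative with unit $\eta$, $\Delta$ coassociative with counit $\epsilon$, $\Delta\circ m=(m\otimes m)\circ(1324)\circ(\Delta\otimes\Delta)$, $\Delta\circ\eta=\eta\otimes\eta$, $\epsilon\circ m=\epsilon\otimes\epsilon$, $\epsilon\circ\eta=1$. $\underline{\mathrm{Bialg}}_{\mathrm{qcoco}}$: quotient of $\underline{\mathrm{Bialg}}[[\hbar]]\langle\tilde\delta\rangle/(\Delta-(21)\circ\Delta=\hbar\tilde\delta)$, $\tilde\delta$ of bidegree $(1,2)$, by its torsion ideal. $\underline{\mathrm{Bialg}}_{\mathrm{cP}}$ (co-Poisson bialgebras): quotient of $\underline{\mathrm{Bialg}}\langle\delta\rangle$, $\delta$ of bidegree $(1,2)$, by $\Delta=(21)\circ\Delta$, $\delta+(21)\circ\delta=0$, $((123)+(231)+(312))\circ(\delta\otimes\mathrm{id})\circ\delta=0$, $(\Delta\otimes\mathrm{id})\circ\delta=((123)+(213))\circ(\mathrm{id}\otimes\delta)\circ\Delta$, $\delta\circ m=(m\otimes m)\circ(1324)\circ(\delta\otimes\Delta+\Delta\otimes\delta)$, $\delta\circ\eta=0$, $(\epsilon\otimes\mathrm{id})\circ\delta=0$. Let $\Delta^{(n)}$ be the iterated coproduct of bidegree $(1,n)$. $J_n$ (resp. $K_n$) is the ideal of $\underline{\mathrm{Bialg}}_{\mathrm{cP}}$ (resp. $\underline{\mathrm{Bialg}}_{\mathrm{qcoco}}$)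 generated by all $(\mathrm{id}-\eta\circ\epsilon)^{\otimes p}\circ\Delta^{(p)}$, $p\ge n$. $\underline{\mathrm{UE}}_{\mathrm{cP}}$ is the completion of $\underline{\mathrm{Bialg}}_{\mathrm{cP}}$ with respect to $(J_n)$ and $\underline{\mathrm{QUE}}$ is the completion of $\underline{\mathrm{Bialg}}_{\mathrm{qcoco}}$ with respect to $(K_n)$. $\underline{\mathrm{SC}}:\underline{\mathrm{UE}}_{\mathrm{cP}}\to\underline{\mathrm{QUE}}/(\hbar)$ is the surjective prop morphism induced by $m,\Delta,\eta,\epsilon\mapsto$ their classes, $\delta\mapsto$ class of $\tilde\delta$. A quantization morphism is a prop morphism $\underline Q:\underline{\mathrm{QUE}}\to\underline{\mathrm{UE}}_{\mathrm{cP}}[[\hbar]]$ with $(\underline Q\ \mathrm{mod}\ \hbar)\circ\underline{\mathrm{SC}}=\mathrm{id}$. (Quantization morphisms exist by work of Etingof and Kazhdan.) $\mathrm{Aut}_1$ denotes the group of prop automorphisms whose reduction modulo $\hbar$ is the identity. *)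

(* Defs.v *)
From HB Require Import structures.
From mathcomp Require Import all_boot all_order all_algebra all_fingroup.
From mathcomp Require Import boolp.

Set Implicit Arguments.
Unset Strict Implicit.
Unset Printing Implicit Defensive.

Import GRing.Theory.
Local Open Scope ring_scope.
Local Open Scope quotient_scope.

(* [fps V] is V[[h]], for V a ring or a module. *)
Definition fps (V : Type) := nat -> V.

HB.instance Definition _ (V : Type) := gen_eqMixin (fps V).
HB.instance Definition _ (V : Type) := gen_choiceMixin (fps V).

Section FpsZmod.
Variable V : zmodType.
Implicit Types f g h : fps V.

Definition fps_zero : fps V := fun=> 0.
Definition fps_opp f : fps V := fun n => - f n.
Definition fps_add f g : fps V := fun n => f n + g n.

Lemma fps_addA : associative fps_add.
Proof. by move=> f g h; apply: funext => n; exact: addrA. Qed.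
Lemma fps_addC : commutative fps_add.
Proof. by move=> f g; apply: funext => n; exact: addrC. Qed.
Lemma fps_add0 : left_id fps_zero fps_add.
Proof. by move=> f; apply: funext => n; exact: add0r. Qed.
Lemma fps_addN : left_inverse fps_zero fps_opp fps_add.
Proof. by move=> f; apply: funext => n; exact: addNr. Qed.

HB.instance Definition _ :=
  GRing.isZmodule.Build (fps V) fps_addA fps_addC fps_add0 fps_addN.

Definition fps_mono (x : V) (k : nat) : fps V :=
  fun n => if n == k then x else 0.
Definition fps_cst (x : V) : fps V := fps_mono x 0.

Lemma fps_addE f g n : (f + g) n = f n + g n. Proof. by []. Qed.

End FpsZmod.

Definition fps_conv (U V W : zmodType) (b : U -> V -> W) (f : fps U) (g : fps V)
    : fps W :=
  fun n => \sum_(i < n.+1) b (f i) (g (n - i)%N).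

Definition fps_map (U V : Type) (a : U -> V) (f : fps U) : fps V :=
  fun n => a (f n).

(* Identities between iterated Cauchy products are checked on monomials. *)
Section FpsExt.

Definition fps_good (U V : zmodType) (F : fps U -> fps V) : Prop :=
  (forall f g, F (f + g) = F f + F g) /\
  (forall n f g, (forall i, (i <= n)%N -> f i = g i) -> F f n = F g n).

Definition biadditive (U V W : zmodType) (b : U -> V -> W) : Prop :=
  (forall x y z, b (x + y) z = b x z + b y z) /\
  (forall x y z, b x (y + z) = b x y + b x z).

Lemma fps_good_id (U : zmodType) : fps_good (fun f : fps U => f).
Proof. by split=> // n f g; apply. Qed.

Lemma fps_good_conv_l (T U V W : zmodType) (b : U -> V -> W)
    (F : fps T -> fps U) (g : fps V) :
  biadditive b -> fps_good F -> fps_good (fun f => fps_conv b (F f) g).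
Proof.
move=> [bl br] [FD FL]; split=> [f f'|n f f' e].
  apply: funext => n; rewrite FD /fps_conv fps_addE -big_split.
  by apply: eq_bigr => i _; exact: bl.
apply: eq_bigr => i _; congr (b _ _); apply: FL => j ji.
by apply: e; rewrite (leq_trans ji) // -ltnS.
Qed.

Lemma fps_good_conv_r (T U V W : zmodType) (b : U -> V -> W)
    (F : fps T -> fps V) (f : fps U) :
  biadditive b -> fps_good F -> fps_good (fun g => fps_conv b f (F g)).
Proof.
move=> [bl br] [FD FL]; split=> [g g'|n g g' e].
  apply: funext => n; rewrite FD /fps_conv fps_addE -big_split.
  by apply: eq_bigr => i _; exact: br.
apply: eq_bigr => i _; congr (b _ _); apply: FL => j ji.
by apply: e; rewrite (leq_trans ji) // leq_subr.
Qed.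

Lemma fps_good_map (T U V : zmodType) (a : U -> V) (F : fps T -> fps U) :
  (forall x y, a (x + y) = a x + a y) -> fps_good F ->
  fps_good (fun f => fps_map a (F f)).
Proof.
move=> aD [FD FL]; split=> [f f'|n f f' e].
  by apply: funext => n; rewrite FD [LHS]aD.
by congr a; exact: FL.
Qed.

Lemma fps_good_ext (U V : zmodType) (F G : fps U -> fps V) :
  fps_good F -> fps_good G ->
  (forall x k, F (fps_mono x k) = G (fps_mono x k)) -> forall f, F f = G f.
Proof.
move=> [FD FL] [GD GL] e f; apply: funext => n.
pose t m : fps U := \sum_(i < m) fps_mono (f i) i.
have tE m j : t m j = if (j < m)%N then f j else 0.
  elim: m => [|m IH]; first by rewrite /t big_ord0.
  rewrite /t big_ord_recr /= fps_addE -/(t m) IH /fps_mono ltnS.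
  by case: (ltngtP j m) => [_|_|->]; rewrite ?addr0 ?add0r.
have -> : F f n = F (t n.+1) n.
  by apply: FL => i lin; rewrite tE ltnS lin.
have -> : G f n = G (t n.+1) n.
  by apply: GL => i lin; rewrite tE ltnS lin.
congr (_ n); elim: (n.+1) => [|m IH].
  rewrite /t big_ord0.
  have F0 : F 0 = 0 by apply: (addrI (F 0)); rewrite -FD !addr0.
  have G0 : G 0 = 0 by apply: (addrI (G 0)); rewrite -GD !addr0.
  by rewrite F0 G0.
by rewrite /t big_ord_recr /= FD GD e -/(t m) IH.
Qed.

Lemma fps_conv_mono (U V W : zmodType) (b : U -> V -> W) x y i j :
  biadditive b ->
  fps_conv b (fps_mono x i) (fps_mono y j) = fps_mono (b x y) (i + j).
Proof.
move=> [bl br]; have b0 z : b 0 z = 0.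
  by apply: (addrI (b 0 z)); rewrite -bl !addr0.
have b0r z : b z 0 = 0 by apply: (addrI (b z 0)); rewrite -br !addr0.
apply: funext => n; rewrite /fps_conv /fps_mono.
case: (leqP i n) => [lin|ltn]; last first.
  rewrite big1 => [|k _].
    case: eqP => // e; by rewrite e ltnNge leq_addr in ltn.
  by rewrite ltn_eqF ?b0 // (leq_trans _ ltn) // ltnS -ltnS.
rewrite (bigD1 (Ordinal (lin : i < n.+1)%N)) //= eqxx big1 ?addr0.
  have -> : (n - i == j)%N = (n == i + j)%N.
    by rewrite -(eqn_add2l i) subnKC.
  by case: eqP.
by move=> k; rewrite -val_eqE /= => /negbTE ->; rewrite b0.
Qed.

Lemma fps_map_mono (U V : zmodType) (a : U -> V) x k :
  (forall x y, a (x + y) = a x + a y) ->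
  fps_map a (fps_mono x k) = fps_mono (a x) k.
Proof.
move=> aD; apply: funext => n; rewrite /fps_map /fps_mono; case: eqP => // _.
by apply: (addrI (a 0)); rewrite -aD !addr0.
Qed.

End FpsExt.

Ltac fgood :=
  match goal with
  | |- biadditive _ => match goal with H : _ |- _ => exact: H end
  | |- fps_good (fun f => f) => exact (fps_good_id _)
  | |- fps_good (fun f => fps_conv ?b (@?F f) ?g) =>
      refine (@fps_good_conv_l _ _ _ _ b F g _ _); fgood
  | |- fps_good (fun f => fps_conv ?b ?g (@?F f)) =>
      refine (@fps_good_conv_r _ _ _ _ b F g _ _); fgood
  | |- fps_good (fun f => fps_map ?a (@?F f)) =>
      refine (@fps_good_map _ _ _ a F _ _);
      [match goal with H : _ |- _ => exact: H end | fgood]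
  | |- fps_good (fps_map ?a) =>
      refine (@fps_good_map _ _ _ a (fun f => f) _ _);
      [match goal with H : _ |- _ => exact: H end | fgood]
  | |- fps_good (fps_conv ?b ?g) =>
      refine (@fps_good_conv_r _ _ _ _ b (fun f => f) g _ _); fgood
  end.

Section FpsRing.
Variable K : comNzRingType.

Let mul := fps_conv (@GRing.mul K).
Let one : fps K := fps_cst 1.

Let mulB : biadditive (@GRing.mul K).
Proof. by split=> x y z; rewrite (mulrDl, mulrDr). Qed.

Let mulA : associative mul.
Proof.
rewrite /mul.
move=> f g h; move: f; apply: fps_good_ext; try by fgood.
move=> x i; move: g; apply: fps_good_ext; try by fgood.
move=> y j; move: h; apply: fps_good_ext; try by fgood.
by move=> z k; rewrite !fps_conv_mono // mulrA addnA.
Qed.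

Let mulC : commutative mul.
Proof.
rewrite /mul.
move=> f g; move: f; apply: fps_good_ext; try by fgood.
move=> x i; move: g; apply: fps_good_ext; try by fgood.
by move=> y j; rewrite !fps_conv_mono // mulrC addnC.
Qed.

Let mul1 : left_id one mul.
Proof.
rewrite /mul.
apply: fps_good_ext; try by fgood.
by move=> y j; rewrite fps_conv_mono // mul1r.
Qed.

Let mulD : left_distributive mul +%R.
Proof.
have gl := fps_good_conv_l; have gi := fps_good_id.
by move=> f g h; exact: (proj1 (fps_good_conv_l h mulB (fps_good_id K)) f g).
Qed.

Let one_neq0 : one != 0.
Proof.
apply/eqP => /(congr1 (fun f : fps K => f 0)) /eqP.
by rewrite /one /fps_cst /fps_mono eqxx oner_eq0.
Qed.

HB.instance Definition _ := GRing.Zmodule_isComNzRing.Build (fps K)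
  mulA mulC mul1 mulD one_neq0.

Definition hbar : fps K := fps_mono 1 1.

End FpsRing.

Section FpsLmod.
Variables (K : comNzRingType) (V : lmodType K).

Definition fps_scale (a : fps K) (f : fps V) : fps V := fps_conv *:%R a f.

Lemma scale_biadditive : biadditive (fun (a : K) (v : V) => a *: v).
Proof. by split=> x y z; rewrite (scalerDl, scalerDr). Qed.

Let mulB : biadditive (@GRing.mul K).
Proof. by split=> x y z; rewrite (mulrDl, mulrDr). Qed.

Let scaleA a b f : fps_scale a (fps_scale b f) = fps_scale (a * b) f.
Proof.
have sb := scale_biadditive.
have -> : a * b = fps_conv *%R a b by [].
rewrite /fps_scale.
move: a; apply: fps_good_ext; try by fgood.
move=> x i; move: b; apply: fps_good_ext; try by fgood.
move=> y j; move: f; apply: fps_good_ext; try by fgood.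
by move=> z k; rewrite !fps_conv_mono // scalerA addnA.
Qed.

Let scale1 : left_id 1 fps_scale.
Proof.
rewrite /fps_scale.
have sb := scale_biadditive.
apply: fps_good_ext; try by fgood.
by move=> y j; rewrite fps_conv_mono // scale1r.
Qed.

Let scaleDr : right_distributive fps_scale +%R.
Proof.
by move=> a; case: (fps_good_conv_r a scale_biadditive (fps_good_id V)).
Qed.

Let scaleDl f : {morph fps_scale^~ f : a b / a + b}.
Proof.
by move=> a; case: (fps_good_conv_l f scale_biadditive (fps_good_id K)).
Qed.

HB.instance Definition _ := GRing.Zmodule_isLmodule.Build (fps K) (fps V)
  scaleA scale1 scaleDr scaleDl.

End FpsLmod.

Record submodule (R : comNzRingType) (M : lmodType R) := Submodule {
  smem :> M -> Prop;
  smem0 : smem 0;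
  smemP : forall a x y, smem x -> smem y -> smem (a *: x + y) }.

Section QuotMod.
Variables (R : comNzRingType) (M : lmodType R) (S : submodule M).

Lemma smemZ a x : S x -> S (a *: x).
Proof. by move=> Sx; rewrite -[_ *: _]addr0; apply: smemP Sx (smem0 S). Qed.
Lemma smemD x y : S x -> S y -> S (x + y).
Proof. by move=> Sx Sy; rewrite -[x]scale1r; apply: smemP. Qed.
Lemma smemN x : S x -> S (- x).
Proof. by rewrite -scaleN1r; exact: smemZ. Qed.

Definition quot_rel : rel M := fun x y => `[< S (x - y) >].

Lemma quot_rel_equiv : equiv_class_of quot_rel.
Proof.
split=> [x|x y|y x z].
- by apply/asboolP; rewrite subrr; exact: smem0.
- by apply/asboolP/asboolP => /smemN; rewrite opprB.
move=> /asboolP xy /asboolP yz; apply/asboolP.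
by rewrite -(subrKA y); exact: smemD.
Qed.

Canonical quot_equiv := EquivRelPack quot_rel_equiv.

Definition quotmod := {eq_quot quot_rel}.
HB.instance Definition _ := Choice.on quotmod.

Definition qpi (x : M) : quotmod := \pi_({eq_quot quot_rel}) x.
Definition qrepr (x : quotmod) : M := generic_quotient.repr x.

Lemma qreprK : cancel qrepr qpi. Proof. exact: reprK. Qed.

Lemma qpiP x y : qpi x = qpi y <-> S (x - y).
Proof. by split=> [/eqmodP/asboolP|] // xy; apply/eqmodP/asboolP. Qed.

Lemma qreprP x : S (qrepr (qpi x) - x).
Proof. by apply/qpiP; rewrite qreprK. Qed.

Definition quot_opp (x : quotmod) := qpi (- qrepr x).
Definition quot_add (x y : quotmod) := qpi (qrepr x + qrepr y).
Definition quot_scale a (x : quotmod) := qpi (a *: qrepr x).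

Lemma quot_oppE x : quot_opp (qpi x) = qpi (- x).
Proof. by apply/qpiP; rewrite -opprB opprK addrC; apply/smemN/qreprP. Qed.
Lemma quot_addE x y : quot_add (qpi x) (qpi y) = qpi (x + y).
Proof. by apply/qpiP; rewrite opprD addrACA; apply: smemD; exact: qreprP. Qed.
Lemma quot_scaleE a x : quot_scale a (qpi x) = qpi (a *: x).
Proof. by apply/qpiP; rewrite -scalerBr; apply: smemZ; exact: qreprP. Qed.

Lemma quotW (P : quotmod -> Prop) : (forall x, P (qpi x)) -> forall x, P x.
Proof. by move=> Px x; rewrite -[x]qreprK. Qed.

Lemma quot_addA : associative quot_add.
Proof.
by elim/quotW=> x; elim/quotW=> y; elim/quotW=> z; rewrite !quot_addE addrA.
Qed.
Lemma quot_addC : commutative quot_add.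
Proof. by elim/quotW=> x; elim/quotW=> y; rewrite !quot_addE addrC. Qed.
Lemma quot_add0 : left_id (qpi 0) quot_add.
Proof. by elim/quotW=> x; rewrite quot_addE add0r. Qed.
Lemma quot_addN : left_inverse (qpi 0) quot_opp quot_add.
Proof. by elim/quotW=> x; rewrite quot_oppE quot_addE addNr. Qed.

HB.instance Definition _ := GRing.isZmodule.Build quotmod
  quot_addA quot_addC quot_add0 quot_addN.

Let scaleA a b x : quot_scale a (quot_scale b x) = quot_scale (a * b) x.
Proof. by elim/quotW: x => x; rewrite !quot_scaleE scalerA. Qed.
Let scale1 : left_id 1 quot_scale.
Proof. by elim/quotW=> x; rewrite quot_scaleE scale1r. Qed.
Let scaleDr : right_distributive quot_scale +%R.
Proof.
move=> a; elim/quotW=> x; elim/quotW=> y.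
by rewrite [qpi x + _]quot_addE !quot_scaleE [RHS]quot_addE scalerDr.
Qed.
Let scaleDl x : {morph quot_scale^~ x : a b / a + b}.
Proof.
elim/quotW: x => x a b.
by rewrite !quot_scaleE [RHS]quot_addE scalerDl.
Qed.

HB.instance Definition _ := GRing.Zmodule_isLmodule.Build R quotmod
  scaleA scale1 scaleDr scaleDl.

Lemma qpi_linear a x y : qpi (a *: x + y) = a *: qpi x + qpi y.
Proof.
by rewrite [a *: qpi x]quot_scaleE [RHS]quot_addE.
Qed.

Lemma qpi_eq0 x : qpi x = 0 <-> S x.
Proof. by rewrite [0]/(qpi 0) qpiP subr0. Qed.

End QuotMod.

Section ResMod.
Variables (K : comNzRingType) (M : lmodType (fps K)).

Definition resmod : Type := M.
HB.instance Definition _ := GRing.Zmodule.on resmod.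

Definition res_scale (a : K) (x : resmod) : resmod := (fps_cst a : fps K) *: (x : M).

Lemma fps_cstM (a b : K) : fps_cst (a * b) = fps_cst a * fps_cst b.
Proof.
rewrite [RHS]fps_conv_mono //.
by split=> x y z; rewrite (mulrDl, mulrDr).
Qed.
Lemma fps_cstD (a b : K) : fps_cst (a + b) = fps_cst a + fps_cst b.
Proof.
apply: funext => n; rewrite fps_addE /fps_cst /fps_mono.
by case: eqP; rewrite ?addr0.
Qed.

Let scaleA a b x : res_scale a (res_scale b x) = res_scale (a * b) x.
Proof. by rewrite /res_scale scalerA fps_cstM. Qed.
Let scale1 : left_id 1 res_scale.
Proof. by move=> x; exact: scale1r. Qed.
Let scaleDr : right_distributive res_scale +%R.
Proof. by move=> a x y; exact: scalerDr. Qed.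
Let scaleDl x : {morph res_scale^~ x : a b / a + b}.
Proof. by move=> a b; rewrite /res_scale fps_cstD scalerDl. Qed.

HB.instance Definition _ := GRing.Zmodule_isLmodule.Build K resmod
  scaleA scale1 scaleDr scaleDl.

End ResMod.

Definition limcompat (R : comNzRingType) (M : nat -> lmodType R)
    (t : forall n, M n.+1 -> M n) (x : forall n, M n) : Prop :=
  forall n, t n (x n.+1) = x n.

Record limmod (R : comNzRingType) (M : nat -> lmodType R)
    (t : forall n, M n.+1 -> M n)
    (t_lin : forall n a x y, t n (a *: x + y) = a *: t n x + t n y) := LimMod {
  limval :> forall n, M n;
  limvalP : limcompat t limval }.

Section LimModTheory.
Variables (R : comNzRingType) (M : nat -> lmodType R).
Variable t : forall n, M n.+1 -> M n.
Hypothesis t_lin : forall n a x y, t (a *: x + y) = a *: t x + t y :> M n.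
Notation L := (limmod t_lin).

HB.instance Definition _ := gen_eqMixin L.
HB.instance Definition _ := gen_choiceMixin L.

Lemma lim_ext (x y : L) : (forall n, x n = y n) -> x = y.
Proof.
case: x y => [x xP] [y yP] /= e.
have exy : x = y by apply: functional_extensionality_dep.
by case: _ / exy yP => yP; congr LimMod; exact: Prop_irrelevance.
Qed.

Let t0 n : t 0 = 0 :> M n.
Proof.
by have := @t_lin n (-1) 0 0; rewrite scaler0 addr0 scaleN1r addNr.
Qed.

Let zeroP : limcompat t (fun=> 0). Proof. by move=> n; rewrite t0. Qed.
Let oppP (x : L) : limcompat t (fun n => - x n).
Proof.
move=> n; have := @t_lin n (-1) (x n.+1) 0.
by rewrite t0 !addr0 !scaleN1r limvalP.
Qed.
Let addP (x y : L) : limcompat t (fun n => x n + y n).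
Proof.
move=> n; have := @t_lin n 1 (x n.+1) (y n.+1).
by rewrite !scale1r !limvalP.
Qed.
Let scaleP a (x : L) : limcompat t (fun n => a *: x n).
Proof.
move=> n; have := @t_lin n a (x n.+1) 0.
by rewrite t0 !addr0 limvalP.
Qed.

Definition lim_zero : L := LimMod t_lin zeroP.
Definition lim_opp (x : L) : L := LimMod t_lin (oppP x).
Definition lim_add (x y : L) : L := LimMod t_lin (addP x y).
Definition lim_scale a (x : L) : L := LimMod t_lin (scaleP a x).

Let addA : associative lim_add.
Proof. by move=> x y z; apply: lim_ext => n /=; exact: addrA. Qed.
Let addC : commutative lim_add.
Proof. by move=> x y; apply: lim_ext => n /=; exact: addrC. Qed.
Let add0 : left_id lim_zero lim_add.
Proof. by move=> x; apply: lim_ext => n /=; exact: add0r. Qed.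
Let addN : left_inverse lim_zero lim_opp lim_add.
Proof. by move=> x; apply: lim_ext => n /=; exact: addNr. Qed.

HB.instance Definition _ := GRing.isZmodule.Build L addA addC add0 addN.

Let scaleA a b x : lim_scale a (lim_scale b x) = lim_scale (a * b) x.
Proof. by apply: lim_ext => n /=; exact: scalerA. Qed.
Let scale1 : left_id 1 lim_scale.
Proof. by move=> x; apply: lim_ext => n /=; exact: scale1r. Qed.
Let scaleDr : right_distributive lim_scale +%R.
Proof. by move=> a x y; apply: lim_ext => n /=; exact: scalerDr. Qed.
Let scaleDl x : {morph lim_scale^~ x : a b / a + b}.
Proof. by move=> a b; apply: lim_ext => n /=; exact: scalerDl. Qed.

HB.instance Definition _ := GRing.Zmodule_isLmodule.Build R L
  scaleA scale1 scaleDr scaleDl.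

Lemma limDE (x y : L) n : (x + y) n = x n + y n. Proof. by []. Qed.
Lemma limZE a (x : L) n : (a *: x) n = a *: x n. Proof. by []. Qed.

End LimModTheory.

Reserved Notation "f \oo g" (at level 45, left associativity).
Reserved Notation "f \ox g" (at level 40, left associativity).

(* [P n m] is Hom(O^n, O^m), with n inputs and m outputs; [pperm P s] moves   *)
(* the factor a to the position s a.                                          *)
Record preprop (R : comNzRingType) := Preprop {
  hom :> nat -> nat -> lmodType R;
  pperm : forall n, 'S_n -> hom n n;
  pcomp : forall n m l, hom m l -> hom n m -> hom n l;
  ptens : forall n m n' m', hom n m -> hom n' m' -> hom (n + n') (m + m') }.

Arguments pperm {R} p {n}.
Arguments pcomp {R p n m l}.
Arguments ptens {R p n m n' m'}.

Declare Scope prop_scope.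
Delimit Scope prop_scope with P.
Notation "f \oo g" := (pcomp f g) : prop_scope.
Notation "f \ox g" := (ptens f g) : prop_scope.
Local Open Scope prop_scope.

Definition pid (R : comNzRingType) (P : preprop R) (n : nat) : P n n :=
  pperm P 1%g.

(* Transport along equalities of arities, needed because n + (m + l) and      *)
(* n + m + l, n + 0 and n, n + m and m + n are not convertible.               *)
Definition pcast (R : comNzRingType) (P : preprop R) n n' m m'
    (en : n = n') (em : m = m') (f : P n m) : P n' m' :=
  match en in _ = a, em in _ = b return P a b with erefl, erefl => f end.

Section BlockPerm.
Variables n m : nat.

Definition psum_fun (s : 'S_n) (t : 'S_m) (i : 'I_(n + m)) : 'I_(n + m) :=
  match split i with
  | inl a => lshift m (s a)
  | inr b => rshift n (t b)
  end.

Lemma psum_inj s t : injective (psum_fun s t).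
Proof.
move=> i j; rewrite /psum_fun.
case: (split_ordP i) => a ->; case: (split_ordP j) => b -> /eqP;
  rewrite ?eq_shift // => /eqP /perm_inj -> //.
Qed.

Definition psum (s : 'S_n) (t : 'S_m) : 'S_(n + m) := perm (@psum_inj s t).

(* the first n factors are moved to the last n positions *)
Definition pswap_fun (i : 'I_(n + m)) : 'I_(n + m) :=
  cast_ord (addnC m n)
    match split i with
    | inl a => rshift m a
    | inr b => lshift n b
    end.

Lemma pswap_inj : injective pswap_fun.
Proof.
move=> i j /cast_ord_inj.
case: (split_ordP i) => a ->; case: (split_ordP j) => b -> /eqP;
  by rewrite ?eq_shift // => /eqP ->.
Qed.

Definition pswap : 'S_(n + m) := perm pswap_inj.

End BlockPerm.

Definition pbraid (R : comNzRingType) (P : preprop R) n m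
  : P (n + m)%N (m + n)%N := pcast erefl (addnC n m) (pperm P (pswap n m)).

(* The axioms of an R-linear strict symmetric monoidal category with objects  *)
(* O^n; the symmetric structure is carried by the maps 'S_n -> P n n.         *)
Record is_prop (R : comNzRingType) (P : preprop R) : Prop := IsProp {
  pcomp_linl : forall n m l a (f f' : P m l) (g : P n m),
    (a *: f + f') \oo g = a *: (f \oo g) + f' \oo g;
  pcomp_linr : forall n m l a (f : P m l) (g g' : P n m),
    f \oo (a *: g + g') = a *: (f \oo g) + f \oo g';
  ptens_linl : forall n m n' m' a (f f' : P n m) (g : P n' m'),
    (a *: f + f') \ox g = a *: (f \ox g) + f' \ox g;
  ptens_linr : forall n m n' m' a (f : P n m) (g g' : P n' m'),
    f \ox (a *: g + g') = a *: (f \ox g) + f \ox g';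
  pcompA : forall n m l k (f : P l k) (g : P m l) (h : P n m),
    f \oo (g \oo h) = (f \oo g) \oo h;
  pcomp_idl : forall n m (f : P n m), pid P m \oo f = f;
  pcomp_idr : forall n m (f : P n m), f \oo pid P n = f;
  ptens_comp : forall n m l n' m' l' (f : P m l) (g : P n m)
      (f' : P m' l') (g' : P n' m'),
    (f \oo g) \ox (f' \oo g') = (f \ox f') \oo (g \ox g');
  ptensA : forall n1 m1 n2 m2 n3 m3
      (f : P n1 m1) (g : P n2 m2) (h : P n3 m3),
    f \ox g \ox h
    = pcast (addnA n1 n2 n3) (addnA m1 m2 m3) (f \ox (g \ox h));
  ptens_idl : forall n m (f : P n m), pid P 0 \ox f = f;
  ptens_idr : forall n m (f : P n m),
    f \ox pid P 0 = pcast (esym (addn0 n)) (esym (addn0 m)) f;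
  pperm_comp : forall n (s t : 'S_n),
    pperm P s \oo pperm P t = pperm P (t * s)%g;
  pperm_tens : forall n m (s : 'S_n) (t : 'S_m),
    pperm P s \ox pperm P t = pperm P (psum s t);
  pbraid_nat : forall n m n' m' (f : P n m) (g : P n' m'),
    pbraid P m m' \oo (f \ox g) = (g \ox f) \oo pbraid P n n' }.

Record prop (R : comNzRingType) := PropPack {
  prop_sort :> preprop R;
  propP : is_prop prop_sort }.

Section PropTheory.
Variables (R : comNzRingType) (P : prop R).
Let HP := propP P.

Lemma pcompDl n m l (f f' : P m l) (g : P n m) :
  (f + f') \oo g = f \oo g + f' \oo g.
Proof. by have := pcomp_linl HP 1 f f' g; rewrite !scale1r. Qed.
Lemma pcompDr n m l (f : P m l) (g g' : P n m) :
  f \oo (g + g') = f \oo g + f \oo g'.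
Proof. by have := pcomp_linr HP 1 f g g'; rewrite !scale1r. Qed.
Lemma ptensDl n m n' m' (f f' : P n m) (g : P n' m') :
  (f + f') \ox g = f \ox g + f' \ox g.
Proof. by have := ptens_linl HP 1 f f' g; rewrite !scale1r. Qed.
Lemma ptensDr n m n' m' (f : P n m) (g g' : P n' m') :
  f \ox (g + g') = f \ox g + f \ox g'.
Proof. by have := ptens_linr HP 1 f g g'; rewrite !scale1r. Qed.

Lemma pcomp0l n m l (g : P n m) : (0 : P m l) \oo g = 0.
Proof. by apply: (addrI ((0 : P m l) \oo g)); rewrite -pcompDl !addr0. Qed.
Lemma pcomp0r n m l (f : P m l) : f \oo (0 : P n m) = 0.
Proof. by apply: (addrI (f \oo (0 : P n m))); rewrite -pcompDr !addr0. Qed.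
Lemma ptens0l n m n' m' (g : P n' m') : (0 : P n m) \ox g = 0.
Proof. by apply: (addrI ((0 : P n m) \ox g)); rewrite -ptensDl !addr0. Qed.
Lemma ptens0r n m n' m' (f : P n m) : f \ox (0 : P n' m') = 0.
Proof. by apply: (addrI (f \ox (0 : P n' m'))); rewrite -ptensDr !addr0. Qed.

Lemma pcompZl n m l a (f : P m l) (g : P n m) :
  (a *: f) \oo g = a *: (f \oo g).
Proof. by have := pcomp_linl HP a f 0 g; rewrite pcomp0l !addr0. Qed.
Lemma pcompZr n m l a (f : P m l) (g : P n m) :
  f \oo (a *: g) = a *: (f \oo g).
Proof. by have := pcomp_linr HP a f g 0; rewrite pcomp0r !addr0. Qed.
Lemma ptensZl n m n' m' a (f : P n m) (g : P n' m') :
  (a *: f) \ox g = a *: (f \ox g).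
Proof. by have := ptens_linl HP a f 0 g; rewrite ptens0l !addr0. Qed.
Lemma ptensZr n m n' m' a (f : P n m) (g : P n' m') :
  f \ox (a *: g) = a *: (f \ox g).
Proof. by have := ptens_linr HP a f g 0; rewrite ptens0r !addr0. Qed.

Lemma pcompBl n m l (f f' : P m l) (g : P n m) :
  (f - f') \oo g = f \oo g - f' \oo g.
Proof. by rewrite -scaleN1r pcompDl pcompZl scaleN1r. Qed.
Lemma pcompBr n m l (f : P m l) (g g' : P n m) :
  f \oo (g - g') = f \oo g - f \oo g'.
Proof. by rewrite -scaleN1r pcompDr pcompZr scaleN1r. Qed.
Lemma ptensBl n m n' m' (f f' : P n m) (g : P n' m') :
  (f - f') \ox g = f \ox g - f' \ox g.
Proof. by rewrite -scaleN1r ptensDl ptensZl scaleN1r. Qed.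
Lemma ptensBr n m n' m' (f : P n m) (g g' : P n' m') :
  f \ox (g - g') = f \ox g - f \ox g'.
Proof. by rewrite -scaleN1r ptensDr ptensZr scaleN1r. Qed.

End PropTheory.

Record mor (R : comNzRingType) (P P' : preprop R) := Mor {
  mfun :> forall n m, P n m -> P' n m;
  mor_lin : forall n m a (f g : P n m),
    mfun (a *: f + g) = a *: mfun f + mfun g;
  mor_perm : forall n (s : 'S_n), mfun (pperm P s) = pperm P' s;
  mor_comp : forall n m l (f : P m l) (g : P n m),
    mfun (f \oo g) = mfun f \oo mfun g;
  mor_tens : forall n m n' m' (f : P n m) (g : P n' m'),
    mfun (f \ox g) = mfun f \ox mfun g }.

Section MorTheory.
Variable R : comNzRingType.

Lemma mor_ext (P P' : preprop R) (F G : mor P P') :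
  (forall n m (f : P n m), F n m f = G n m f) -> F = G.
Proof.
case: F G => [F F1 F2 F3 F4] [G G1 G2 G3 G4] /= e.
have eFG : F = G.
  apply: functional_extensionality_dep => n.
  apply: functional_extensionality_dep => m.
  exact: funext.
case: _ / eFG G1 G2 G3 G4 => G1 G2 G3 G4.
by congr Mor; exact: Prop_irrelevance.
Qed.

Section MorLinear.
Variables (P P' : preprop R) (F : mor P P').
Lemma morD n m (f g : P n m) : F n m (f + g) = F n m f + F n m g.
Proof. by have := mor_lin F 1 f g; rewrite !scale1r. Qed.
Lemma mor0 n m : F n m 0 = 0.
Proof. by apply: (addrI (F n m 0)); rewrite -morD !addr0. Qed.
Lemma morZ n m a (f : P n m) : F n m (a *: f) = a *: F n m f.
Proof. by have := mor_lin F a f 0; rewrite mor0 !addr0. Qed.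
Lemma morB n m (f g : P n m) : F n m (f - g) = F n m f - F n m g.
Proof. by rewrite morD -!scaleN1r morZ. Qed.
End MorLinear.

Definition mor_id (P : preprop R) : mor P P.
Proof. by exists (fun n m f => f). Defined.

Definition mor_o (P P' P'' : preprop R) (F : mor P' P'') (G : mor P P') :
  mor P P''.
Proof.
exists (fun n m f => F n m (G n m f)) => *.
- by rewrite !mor_lin.
- by rewrite !mor_perm.
- by rewrite !mor_comp.
- by rewrite !mor_tens.
Defined.

Lemma mor_oE (P P' P'' : preprop R) (F : mor P' P'') (G : mor P P') n m f :
  mor_o F G n m f = F n m (G n m f).
Proof. by []. Qed.

Lemma mor_oA (P P' P'' P''' : preprop R) (F : mor P'' P''') (G : mor P' P'')
    (H : mor P P') : mor_o F (mor_o G H) = mor_o (mor_o F G) H.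
Proof. exact: mor_ext. Qed.
Lemma mor_o_idl (P P' : preprop R) (F : mor P P') : mor_o (mor_id P') F = F.
Proof. exact: mor_ext. Qed.
Lemma mor_o_idr (P P' : preprop R) (F : mor P P') : mor_o F (mor_id P) = F.
Proof. exact: mor_ext. Qed.

Definition is_iso (P P' : preprop R) (F : mor P P') : Prop :=
  exists G : mor P' P, mor_o G F = mor_id P /\ mor_o F G = mor_id P'.

Lemma mor_pid (P P' : preprop R) (F : mor P P') n : F n n (pid P n) = pid P' n.
Proof. exact: mor_perm. Qed.

Lemma mor_cast (P P' : preprop R) (F : mor P P') n n' m m'
    (en : n = n') (em : m = m') (f : P n m) :
  F n' m' (pcast en em f) = pcast en em (F n m f).
Proof. by case: _ / en; case: _ / em. Qed.

Lemma mor_braid (P P' : preprop R) (F : mor P P') n m :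
  F _ _ (pbraid P n m) = pbraid P' n m.
Proof. by rewrite mor_cast mor_perm. Qed.

Lemma is_prop_sep (P : preprop R) :
  (forall n m (f g : P n m),
     (forall (P' : prop R) (F : mor P P'), F n m f = F n m g) -> f = g) ->
  is_prop P.
Proof.
move=> sep; split=> *; apply: sep => P' F; have H := propP P'.
- by rewrite !(mor_comp, mor_lin) pcomp_linl.
- by rewrite !(mor_comp, mor_lin) pcomp_linr.
- by rewrite !(mor_tens, mor_lin) ptens_linl.
- by rewrite !(mor_tens, mor_lin) ptens_linr.
- by rewrite !mor_comp pcompA.
- by rewrite mor_comp mor_pid pcomp_idl.
- by rewrite mor_comp mor_pid pcomp_idr.
- by rewrite !(mor_tens, mor_comp) ptens_comp.
- by rewrite mor_cast !mor_tens ptensA.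
- by rewrite mor_tens mor_pid ptens_idl.
- by rewrite mor_tens mor_pid mor_cast ptens_idr.
- by rewrite mor_comp !mor_perm pperm_comp.
- by rewrite mor_tens !mor_perm pperm_tens.
- by rewrite !(mor_comp, mor_tens) !mor_braid pbraid_nat.
Qed.

Lemma is_prop_surj (P : prop R) (P' : preprop R) (F : mor P P') :
  (forall n m (g : P' n m), exists f, F n m f = g) -> is_prop P'.
Proof.
move=> surj; have H := propP P.
have sI n m (Q : P' n m -> Prop) : (forall f, Q (F n m f)) -> forall g, Q g.
  by move=> QF g; case: (surj n m g) => f <-.
split.
- move=> n m l a; elim/sI=> f; elim/sI=> f'; elim/sI=> g.
  by rewrite -!(mor_comp, mor_lin) pcomp_linl.
- move=> n m l a; elim/sI=> f; elim/sI=> g; elim/sI=> g'.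
  by rewrite -!(mor_comp, mor_lin) pcomp_linr.
- move=> n m n' m' a; elim/sI=> f; elim/sI=> f'; elim/sI=> g.
  by rewrite -!(mor_tens, mor_lin) ptens_linl.
- move=> n m n' m' a; elim/sI=> f; elim/sI=> g; elim/sI=> g'.
  by rewrite -!(mor_tens, mor_lin) ptens_linr.
- move=> n m l k; elim/sI=> f; elim/sI=> g; elim/sI=> h.
  by rewrite -!mor_comp pcompA.
- by move=> n m; elim/sI=> f; rewrite -(mor_pid F) -mor_comp pcomp_idl.
- by move=> n m; elim/sI=> f; rewrite -(mor_pid F) -mor_comp pcomp_idr.
- move=> n m l n' m' l'; elim/sI=> f; elim/sI=> g; elim/sI=> f'; elim/sI=> g'.
  by rewrite -!(mor_tens, mor_comp) ptens_comp.
- move=> n1 m1 n2 m2 n3 m3; elim/sI=> f; elim/sI=> g; elim/sI=> h.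
  by rewrite -!mor_tens -mor_cast ptensA.
- move=> n m; elim/sI=> f.
  by rewrite -(mor_pid F) -mor_tens ptens_idl.
- move=> n m; elim/sI=> f.
  by rewrite -(mor_pid F) -mor_tens -mor_cast ptens_idr.
- by move=> n s t; rewrite -!(mor_perm F) -mor_comp pperm_comp.
- by move=> n m s t; rewrite -!(mor_perm F) -mor_tens pperm_tens.
- move=> n m n' m'; elim/sI=> f; elim/sI=> g.
  by rewrite -!(mor_braid F) -!mor_tens -!mor_comp pbraid_nat.
Qed.

End MorTheory.

Definition family (R : comNzRingType) (P : preprop R) :=
  forall n m, P n m -> Prop.

Definition family_sub (R : comNzRingType) (P : preprop R) (I J : family P) :=
  forall n m f, I n m f -> J n m f.

Record is_ideal (R : comNzRingType) (P : preprop R) (I : family P) : Prop :=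
  IsIdeal {
  ideal0 : forall n m, I n m 0;
  idealL : forall n m a (f g : P n m), I n m f -> I n m g -> I n m (a *: f + g);
  ideal_compl : forall n m l (f : P m l) (g : P n m),
    I n m g -> I n l (f \oo g);
  ideal_compr : forall n m l (f : P m l) (g : P n m),
    I m l f -> I n l (f \oo g);
  ideal_tensl : forall n m n' m' (f : P n m) (g : P n' m'),
    I n' m' g -> I _ _ (f \ox g);
  ideal_tensr : forall n m n' m' (f : P n m) (g : P n' m'),
    I n m f -> I _ _ (f \ox g) }.

Record ideal (R : comNzRingType) (P : preprop R) := Ideal {
  ideal_sort :> forall n m, P n m -> Prop;
  idealP : is_ideal ideal_sort }.

Section GenIdeal.
Variables (R : comNzRingType) (P : preprop R) (S : family P).

Lemma is_ideal_meet (Q : family P -> Prop) :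
  is_ideal (fun n m f => forall I : family P, is_ideal I -> Q I -> I n m f).
Proof.
split.
- by move=> n m I [].
- by move=> n m a f g If Ig I HI QI; apply: (idealL HI); [exact: If|exact: Ig].
- by move=> n m l f g Ig I HI QI; apply: (ideal_compl HI); exact: Ig.
- by move=> n m l f g Ig I HI QI; apply: (ideal_compr HI); exact: Ig.
- by move=> n m n' m' f g Ig I HI QI; apply: (ideal_tensl HI); exact: Ig.
- by move=> n m n' m' f g Ig I HI QI; apply: (ideal_tensr HI); exact: Ig.
Qed.

Definition gen_ideal : ideal P := Ideal (is_ideal_meet (family_sub S)).

End GenIdeal.

Section QuotProp.
Variables (R : comNzRingType) (P : prop R) (I : ideal P).
Let HP := propP P.
Let HI := idealP I.

Definition ideal_submod n m : submodule (P n m) :=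
  @Submodule R (P n m) (@ideal_sort _ _ I n m) (ideal0 HI n m)
    (@idealL _ _ _ HI n m).

Definition quotP_pre : preprop R :=
  @Preprop R (fun n m => quotmod (ideal_submod n m))
    (fun n s => qpi _ (pperm P s))
    (fun n m l f g => qpi _ (qrepr f \oo qrepr g))
    (fun n m n' m' f g => qpi _ (qrepr f \ox qrepr g)).

Let compB n m l (f f' : P m l) (g g' : P n m) :
  I _ _ (f - f') -> I _ _ (g - g') -> I _ _ (f \oo g - f' \oo g').
Proof.
move=> If Ig.
have -> : f \oo g - f' \oo g' = 1 *: ((f - f') \oo g) + f' \oo (g - g').
  by rewrite scale1r pcompBl pcompBr addrA subrK.
by apply: (idealL HI); [apply: (ideal_compr HI)|apply: (ideal_compl HI)].
Qed.

Let tensB n m n' m' (f f' : P n m) (g g' : P n' m') :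
  I _ _ (f - f') -> I _ _ (g - g') -> I _ _ (f \ox g - f' \ox g').
Proof.
move=> If Ig.
have -> : f \ox g - f' \ox g' = 1 *: ((f - f') \ox g) + f' \ox (g - g').
  by rewrite scale1r ptensBl ptensBr addrA subrK.
by apply: (idealL HI); [apply: (ideal_tensr HI)|apply: (ideal_tensl HI)].
Qed.

Definition quot_mor_pre : mor P quotP_pre.
Proof.
exists (fun n m f => qpi (ideal_submod n m) f) => //.
- by move=> *; exact: qpi_linear.
- move=> n m l f g; apply/qpiP.
  by apply: compB; rewrite -opprB; apply/(@smemN _ _ (ideal_submod _ _))/qreprP.
- move=> n m n' m' f g; apply/qpiP.
  by apply: tensB; rewrite -opprB; apply/(@smemN _ _ (ideal_submod _ _))/qreprP.
Defined.

Lemma quot_mor_surj n m (g : quotP_pre n m) : exists f, quot_mor_pre n m f = g.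
Proof. by exists (qrepr g); exact: qreprK. Qed.

Definition quotP : prop R := PropPack (is_prop_surj quot_mor_surj).
Definition quot_mor : mor P quotP := quot_mor_pre.

Lemma quot_morP n m (f g : P n m) :
  quot_mor n m f = quot_mor n m g <-> I n m (f - g).
Proof. exact: qpiP. Qed.

Lemma quot_mor_ind n m (Q : quotP n m -> Prop) :
  (forall f, Q (quot_mor n m f)) -> forall g, Q g.
Proof. by move=> Qf g; case: (quot_mor_surj g) => f <-. Qed.

End QuotProp.

Section QuotMap.
Variables (R : comNzRingType) (P P' : prop R) (I : ideal P) (I' : ideal P').
Variable F : mor P P'.
Hypothesis sub : forall n m f, I n m f -> I' n m (F n m f).

Let quot_mapE n m (f : P n m) :
  quot_mor I' n m (F n m (qrepr (quot_mor I n m f))) = quot_mor I' n m (F n m f).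
Proof.
apply/quot_morP.
by rewrite -morB; apply: sub; exact: qreprP.
Qed.

Definition quot_map : mor (quotP I) (quotP I').
Proof.
exists (fun n m f => quot_mor I' n m (F n m (qrepr f))).
- move=> n m a; elim/quot_mor_ind=> f; elim/quot_mor_ind=> g.
  by rewrite -mor_lin !quot_mapE !mor_lin.
- by move=> n s; rewrite -(mor_perm (quot_mor I)) quot_mapE !mor_perm.
- move=> n m l; elim/quot_mor_ind=> f; elim/quot_mor_ind=> g.
  by rewrite -mor_comp !quot_mapE !mor_comp.
- move=> n m n' m'; elim/quot_mor_ind=> f; elim/quot_mor_ind=> g.
  by rewrite -mor_tens !quot_mapE !mor_tens.
Defined.

Lemma quot_map_pi n m (f : P n m) :
  quot_map n m (quot_mor I n m f) = quot_mor I' n m (F n m f).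
Proof. exact: quot_mapE. Qed.

End QuotMap.

Record filtration (R : comNzRingType) (P : preprop R) := Filtration {
  filt :> nat -> ideal P;
  filt_decr : forall k, family_sub (filt k.+1) (filt k) }.

Section Completion.
Variables (R : comNzRingType) (P : prop R) (I : filtration P).

Definition comp_trans k : mor (quotP (I k.+1)) (quotP (I k)) :=
  quot_map (F := mor_id P) (@filt_decr _ _ I k).

Definition comp_hom n m : lmodType R :=
  @limmod R (fun k => quotP (I k) n m) (fun k => comp_trans k n m)
    (fun k => @mor_lin _ _ _ (comp_trans k) n m).

Definition comp_pre : preprop R.
Proof.
exists comp_hom.
- move=> n s; exists (fun k => pperm (quotP (I k)) s) => k.
  exact: (mor_perm (comp_trans k)).
- move=> n m l f g; exists (fun k => f k \oo g k) => k.
  rewrite (mor_comp (comp_trans k)).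
  by congr (_ \oo _); [exact: (limvalP f k)|exact: (limvalP g k)].
- move=> n m n' m' f g; exists (fun k => f k \ox g k) => k.
  rewrite (mor_tens (comp_trans k)).
  by congr (_ \ox _); [exact: (limvalP f k)|exact: (limvalP g k)].
Defined.

Definition comp_proj_pre k : mor comp_pre (quotP (I k)).
Proof. by exists (fun n m (f : comp_pre n m) => f k). Defined.

Lemma comp_is_prop : is_prop comp_pre.
Proof.
apply: is_prop_sep => n m f g e; apply: lim_ext => k.
exact: (e _ (comp_proj_pre k)).
Qed.

Definition completion : prop R := PropPack comp_is_prop.

Definition comp_proj k : mor completion (quotP (I k)) := comp_proj_pre k.

Definition comp_in : mor P completion.
Proof.
unshelve eexists.
- move=> n m f; exists (fun k => quot_mor (I k) n m f) => k.
  exact: quot_map_pi.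
- by move=> n m a f g; apply: lim_ext => k; exact: (mor_lin (quot_mor (I k))).
- by move=> n s; apply: lim_ext => k; exact: (mor_perm (quot_mor (I k))).
- by move=> n m l f g; apply: lim_ext => k; exact: (mor_comp (quot_mor (I k))).
- move=> n m n' m' f g; apply: lim_ext => k.
  exact: (mor_tens (quot_mor (I k))).
Defined.

End Completion.

Inductive term (R : comNzRingType) (G : nat -> nat -> Type) :
    nat -> nat -> Type :=
| TGen n m : G n m -> term R G n m
| TPerm n : 'S_n -> term R G n n
| TComp n m l : term R G m l -> term R G n m -> term R G n l
| TTens n m n' m' :
    term R G n m -> term R G n' m' -> term R G (n + n') (m + m')
| TZero n m : term R G n m
| TAdd n m : term R G n m -> term R G n m -> term R G n m
| TScale n m : R -> term R G n m -> term R G n m.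

Arguments TPerm {R G n}.
Arguments TZero {R G n m}.

Section FreeProp.
Variables (R : comNzRingType) (G : nat -> nat -> Type).

Definition assignment (P : preprop R) := forall n m, G n m -> P n m.

Fixpoint eval (P : preprop R) (a : assignment P) n m (t : term R G n m) :
    P n m :=
  match t in term _ _ n m return P n m with
  | TGen n m x => a n m x
  | TPerm n s => pperm P s
  | TComp n m l t u => eval a t \oo eval a u
  | TTens n m n' m' t u => eval a t \ox eval a u
  | TZero n m => 0
  | TAdd n m t u => eval a t + eval a u
  | TScale n m c t => c *: eval a t
  end.

(* Terms are identified when the axioms of props force them to be equal, i.e. *)
(* when they have the same value for all assignments of the generators.       *)
Definition term_eq n m : rel (term R G n m) := fun t u =>
  `[< forall (P : prop R) (a : assignment P), eval a t = eval a u >].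

HB.instance Definition _ n m := gen_eqMixin (term R G n m).
HB.instance Definition _ n m := gen_choiceMixin (term R G n m).

Lemma term_eq_equiv n m : equiv_class_of (@term_eq n m).
Proof.
split=> [t|t u|t u v].
- exact/asboolP.
- by apply/asboolP/asboolP=> e P a; rewrite e.
- by move=> /asboolP e /asboolP e'; apply/asboolP=> P a; rewrite e e'.
Qed.

Canonical term_equiv n m := EquivRelPack (term_eq_equiv n m).

Definition fhom n m := {eq_quot @term_eq n m}.
HB.instance Definition _ n m := Choice.on (fhom n m).

Definition fpi n m (t : term R G n m) : fhom n m := \pi_({eq_quot @term_eq n m}) t.

Definition feval (P : prop R) (a : assignment P) n m (x : fhom n m) : P n m :=
  eval a (generic_quotient.repr x).

Lemma feval_pi (P : prop R) (a : assignment P) n m (t : term R G n m) :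
  feval a (fpi t) = eval a t.
Proof.
have e : fpi (generic_quotient.repr (fpi t)) = fpi t by exact: reprK.
by move/eqmodP/asboolP: e; exact.
Qed.

Lemma fpi_surj n m (x : fhom n m) : exists t, fpi t = x.
Proof. by exists (generic_quotient.repr x); exact: reprK. Qed.

Lemma fhom_ext n m (x y : fhom n m) :
  (forall (P : prop R) (a : assignment P), feval a x = feval a y) -> x = y.
Proof.
have [t <-] := fpi_surj x; have [u <-] := fpi_surj y => e.
by apply/eqmodP/asboolP => P a; have := e P a; rewrite !feval_pi.
Qed.

Local Notation rep := generic_quotient.repr.

Definition fzero n m : fhom n m := fpi TZero.
Definition fadd n m (x y : fhom n m) : fhom n m := fpi (TAdd (rep x) (rep y)).
Definition fscale n m a (x : fhom n m) : fhom n m := fpi (TScale a (rep x)).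
Definition fopp n m (x : fhom n m) : fhom n m := fscale (-1) x.

Section Feval.
Variables (P : prop R) (a : assignment P).
Lemma feval0 n m : feval a (fzero n m) = 0. Proof. exact: feval_pi. Qed.
Lemma fevalD n m (x y : fhom n m) : feval a (fadd x y) = feval a x + feval a y.
Proof. exact: feval_pi. Qed.
Lemma fevalZ n m c (x : fhom n m) : feval a (fscale c x) = c *: feval a x.
Proof. exact: feval_pi. Qed.
End Feval.

Let fE := (fevalD, fevalZ, feval0).

Let addA n m : associative (@fadd n m).
Proof. by move=> x y z; apply: fhom_ext => P a; rewrite !fE addrA. Qed.
Let addC n m : commutative (@fadd n m).
Proof. by move=> x y; apply: fhom_ext => P a; rewrite !fE addrC. Qed.
Let add0 n m : left_id (fzero n m) (@fadd n m).
Proof. by move=> x; apply: fhom_ext => P a; rewrite !fE add0r. Qed.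
Let addN n m : left_inverse (fzero n m) (@fopp n m) (@fadd n m).
Proof. by move=> x; apply: fhom_ext => P a; rewrite !fE scaleN1r addNr. Qed.

HB.instance Definition _ n m := GRing.isZmodule.Build (fhom n m)
  (@addA n m) (@addC n m) (@add0 n m) (@addN n m).

Let scaleA n m a b (x : fhom n m) : fscale a (fscale b x) = fscale (a * b) x.
Proof. by apply: fhom_ext => P c; rewrite !fE scalerA. Qed.
Let scale1 n m : left_id 1 (@fscale n m).
Proof. by move=> x; apply: fhom_ext => P a; rewrite !fE scale1r. Qed.
Let scaleDr n m : right_distributive (@fscale n m) +%R.
Proof. by move=> a x y; apply: fhom_ext => P c; rewrite !fE scalerDr. Qed.
Let scaleDl n m (x : fhom n m) : {morph (@fscale n m)^~ x : a b / a + b}.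
Proof. by move=> a b; apply: fhom_ext => P c; rewrite !fE scalerDl. Qed.

HB.instance Definition _ n m := GRing.Zmodule_isLmodule.Build R (fhom n m)
  (@scaleA n m) (@scale1 n m) (@scaleDr n m) (@scaleDl n m).

Definition freeP_pre : preprop R :=
  @Preprop R fhom
    (fun n s => fpi (TPerm s))
    (fun n m l x y => fpi (TComp (rep x) (rep y)))
    (fun n m n' m' x y => fpi (TTens (rep x) (rep y))).

Definition free_eval_pre (P : prop R) (a : assignment P) : mor freeP_pre P.
Proof.
exists (fun n m => @feval P a n m).
- by move=> n m c x y; rewrite [LHS]fevalD [feval a (c *: x)]fevalZ.
- by move=> n s; exact: feval_pi.
- by move=> n m l x y; exact: feval_pi.
- by move=> n m n' m' x y; exact: feval_pi.
Defined.

Lemma freeP_is_prop : is_prop freeP_pre.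
Proof.
apply: is_prop_sep => n m x y e; apply: fhom_ext => P a.
exact: (e P (free_eval_pre a)).
Qed.

Definition freeP : prop R := PropPack freeP_is_prop.

Definition free_gen n m (x : G n m) : freeP n m := fpi (TGen R x).

Definition free_eval (P : prop R) (a : assignment P) : mor freeP P :=
  free_eval_pre a.

Lemma free_eval_gen (P : prop R) (a : assignment P) n m (x : G n m) :
  free_eval a n m (free_gen x) = a n m x.
Proof. exact: feval_pi. Qed.

End FreeProp.

Section Adjoin.
Variables (R : comNzRingType) (P : prop R) (G : nat -> nat -> Type).

Definition adj_gen n m : Type := (P n m + G n m)%type.

Let old n m (f : P n m) : freeP R adj_gen n m := free_gen R (inl f : adj_gen n m).

(* the relations making the inclusion of P a prop morphism *)
Inductive adj_rel : family (freeP R adj_gen) :=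
| adj_lin n m a (f g : P n m) :
    adj_rel (old (a *: f + g) - (a *: old f + old g))
| adj_perm n (s : 'S_n) : adj_rel (old (pperm P s) - pperm _ s)
| adj_comp n m l (f : P m l) (g : P n m) :
    adj_rel (old (f \oo g) - old f \oo old g)
| adj_tens n m n' m' (f : P n m) (g : P n' m') :
    adj_rel (old (f \ox g) - old f \ox old g).

(* P<G>, purely algebraic, without completion when R = K[[h]] *)
Definition adjoin : prop R := quotP (gen_ideal adj_rel).

Definition adjoin_new n m (x : G n m) : adjoin n m :=
  quot_mor _ n m (free_gen R (inr x : adj_gen n m)).

Definition adjoin_old : mor P adjoin.
Proof.
pose q := quot_mor (gen_ideal adj_rel).
exists (fun n m f => q n m (old f)).
- move=> n m a f g; rewrite -(mor_lin q); apply/quot_morP => I _; apply.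
  exact: adj_lin.
- move=> n s; rewrite -(mor_perm q); apply/quot_morP => I _; apply.
  exact: adj_perm.
- move=> n m l f g; rewrite -(mor_comp q); apply/quot_morP => I _; apply.
  exact: adj_comp.
- move=> n m n' m' f g; rewrite -(mor_tens q); apply/quot_morP => I _; apply.
  exact: adj_tens.
Defined.

End Adjoin.

Section FpsProp.
Variables (K : comNzRingType) (P : prop K).
Let HP := propP P.

Definition fpsP_pre : preprop (fps K) :=
  @Preprop (fps K) (fun n m => fps (P n m))
    (fun n s => fps_cst (pperm P s))
    (fun n m l f g => fps_conv (fun x y => x \oo y) f g)
    (fun n m n' m' f g => fps_conv (fun x y => x \ox y) f g).

Let compB n m l : biadditive (fun (x : P m l) (y : P n m) => x \oo y).
Proof. by split=> x y z; rewrite (pcompDl, pcompDr). Qed.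
Let tensB n m n' m' : biadditive (fun (x : P n m) (y : P n' m') => x \ox y).
Proof. by split=> x y z; rewrite (ptensDl, ptensDr). Qed.
Let scaleB n m := scale_biadditive (P n m).

Let castE n n' m m' (en : n = n') (em : m = m') (f : fpsP_pre n m) :
  pcast en em f = fps_map (@pcast _ P _ _ _ _ en em) f :> fps (P n' m').
Proof. by case: _ / en; case: _ / em. Qed.

Let castD n n' m m' (en : n = n') (em : m = m') (f g : P n m) :
  pcast en em (f + g) = pcast en em f + pcast en em g.
Proof. by case: _ / en; case: _ / em. Qed.

Let braidE n m : pbraid fpsP_pre n m = fps_cst (pbraid P n m) :> fps _.
Proof.
by rewrite /pbraid castE [LHS]fps_map_mono //; exact: castD.
Qed.

Lemma fpsP_is_prop : is_prop fpsP_pre.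
Proof.
have cD := castD; have cB := compB; have tB := tensB; have sB := scaleB.
split.
- move=> n m l a f f' g; rewrite /= (proj1 (fps_good_conv_l g (@compB n m l) (fps_good_id _))).
  congr (_ + _); rewrite /GRing.scale /= /fps_scale.
  move: a; apply: fps_good_ext; try by fgood.
  move=> a i; move: f; apply: fps_good_ext; try by fgood.
  move=> f j; move: g; apply: fps_good_ext; try by fgood.
  by move=> g k; rewrite !fps_conv_mono // pcompZl addnA.
- move=> n m l a f g g'; rewrite /= (proj1 (fps_good_conv_r f (@compB n m l) (fps_good_id _))).
  congr (_ + _); rewrite /GRing.scale /= /fps_scale.
  move: a; apply: fps_good_ext; try by fgood.
  move=> a i; move: f; apply: fps_good_ext; try by fgood.
  move=> f j; move: g; apply: fps_good_ext; try by fgood.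
  by move=> g k; rewrite !fps_conv_mono // pcompZr addnCA.
- move=> n m n' m' a f f' g; rewrite /= (proj1 (fps_good_conv_l g (@tensB n m n' m') (fps_good_id _))).
  congr (_ + _); rewrite /GRing.scale /= /fps_scale.
  move: a; apply: fps_good_ext; try by fgood.
  move=> a i; move: f; apply: fps_good_ext; try by fgood.
  move=> f j; move: g; apply: fps_good_ext; try by fgood.
  by move=> g k; rewrite !fps_conv_mono // ptensZl addnA.
- move=> n m n' m' a f g g'; rewrite /= (proj1 (fps_good_conv_r f (@tensB n m n' m') (fps_good_id _))).
  congr (_ + _); rewrite /GRing.scale /= /fps_scale.
  move: a; apply: fps_good_ext; try by fgood.
  move=> a i; move: f; apply: fps_good_ext; try by fgood.
  move=> f j; move: g; apply: fps_good_ext; try by fgood.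
  by move=> g k; rewrite !fps_conv_mono // ptensZr addnCA.
- move=> n m l k f g h /=.
  move: f; apply: fps_good_ext; try by fgood.
  move=> f i; move: g; apply: fps_good_ext; try by fgood.
  move=> g j; move: h; apply: fps_good_ext; try by fgood.
  by move=> h q; rewrite !fps_conv_mono // pcompA // addnA.
- move=> n m /=; apply: fps_good_ext; try by fgood.
  by move=> f k; rewrite fps_conv_mono // pcomp_idl.
- move=> n m /=; apply: fps_good_ext; try by fgood.
  by move=> f k; rewrite fps_conv_mono // pcomp_idr // addn0.
- move=> n m l n' m' l' f g f' g' /=.
  move: f; apply: fps_good_ext; try by fgood.
  move=> f i; move: g; apply: fps_good_ext; try by fgood.
  move=> g j; move: f'; apply: fps_good_ext; try by fgood.
  move=> f' k; move: g'; apply: fps_good_ext; try by fgood.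
  by move=> g' q; rewrite !fps_conv_mono // ptens_comp // addnACA.
- move=> n1 m1 n2 m2 n3 m3 f g h; rewrite castE /=.
  move: f; apply: fps_good_ext; try by fgood.
  move=> f i; move: g; apply: fps_good_ext; try by fgood.
  move=> g j; move: h; apply: fps_good_ext; try by fgood.
  move=> h k; rewrite !fps_conv_mono // fps_map_mono; last exact: cD.
  by congr fps_mono; [exact: (ptensA HP)|rewrite addnA].
- move=> n m; pose F f : fps (P n m) := (pid fpsP_pre 0 : fpsP_pre 0 0) \ox f.
  apply: (@fps_good_ext _ _ F (fun f => f)) => [||f k].
  + exact: (fps_good_conv_r _ (@tensB 0 0 n m) (fps_good_id _)).
  + exact: fps_good_id.
  rewrite [LHS](fps_conv_mono _ _ _ _ (@tensB 0 0 n m)).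
  by congr fps_mono; exact: (ptens_idl HP).
- move=> n m f; rewrite castE /=; move: f.
  apply: fps_good_ext; try by fgood.
  move=> f k; rewrite fps_conv_mono // fps_map_mono; last exact: cD.
  by congr fps_mono; [exact: (ptens_idr HP)|rewrite addn0].
- by move=> n s t; rewrite /= fps_conv_mono // pperm_comp.
- by move=> n m s t; rewrite /= fps_conv_mono // pperm_tens.
- move=> n m n' m' f g; rewrite !braidE /=.
  move: f; apply: fps_good_ext; try by fgood.
  move=> f i; move: g; apply: fps_good_ext; try by fgood.
  move=> g j; rewrite !fps_conv_mono // pbraid_nat //.
  by congr fps_mono; rewrite add0n addn0 addnC.
Qed.

Definition fpsP : prop (fps K) := PropPack fpsP_is_prop.

End FpsProp.

Section HAdic.
Variable K : comNzRingType.

Definition hfamily (P : preprop (fps K)) k : family P :=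
  fun n m f => exists g, f = hbar K ^+ k *: g.

Lemma hfamily_ideal (P : prop (fps K)) k : is_ideal (@hfamily P k).
Proof.
split.
- by move=> n m; exists 0; rewrite scaler0.
- move=> n m a _ _ [f ->] [g ->]; exists (a *: f + g).
  by rewrite scalerDr !scalerA mulrC.
- by move=> n m l f _ [g ->]; exists (f \oo g); rewrite pcompZr.
- by move=> n m l _ g [f ->]; exists (f \oo g); rewrite pcompZl.
- by move=> n m n' m' f _ [g ->]; exists (f \ox g); rewrite ptensZr.
- by move=> n m n' m' _ g [f ->]; exists (f \ox g); rewrite ptensZl.
Qed.

Definition hideal (P : prop (fps K)) k : ideal P := Ideal (hfamily_ideal P k).

Lemma hideal_decr (P : prop (fps K)) k :
  family_sub (hideal P k.+1) (hideal P k).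
Proof.
by move=> n m f [g ->]; exists (hbar K *: g); rewrite scalerA -exprSr.
Qed.

Definition hfilt (P : prop (fps K)) : filtration P := Filtration (@hideal_decr P).

Definition hcompletion (P : prop (fps K)) : prop (fps K) := completion (hfilt P).

Definition hclosed (P : preprop (fps K)) (I : family P) : Prop :=
  forall n m (f : P n m),
    (forall k, exists g, I n m g /\ hfamily k (f - g)) -> I n m f.

(* All K[[h]]-modules being complete and separated, ideals of K[[h]]-props    *)
(* are required to be h-adically closed. Linear maps are h-adically           *)
(* continuous, so that nothing has to be added to the definition of [mor].    *)
Definition gen_hideal (P : prop (fps K)) (S : family P) : ideal P :=
  Ideal (is_ideal_meet (fun I => hclosed I /\ family_sub S I)).

Definition torsion (P : preprop (fps K)) : family P :=
  fun n m f => exists a : fps K, a != 0 /\ a *: f = 0.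

Definition resP_pre (P : preprop (fps K)) : preprop K :=
  @Preprop K (fun n m => resmod (P n m))
    (fun n s => pperm P s)
    (fun n m l (f : P m l) (g : P n m) => f \oo g)
    (fun n m n' m' (f : P n m) (g : P n' m') => f \ox g).

Lemma resP_is_prop (P : prop (fps K)) : is_prop (resP_pre P).
Proof.
have H := propP P; split.
- by move=> *; exact: (pcomp_linl H).
- by move=> *; exact: (pcomp_linr H).
- by move=> *; exact: (ptens_linl H).
- by move=> *; exact: (ptens_linr H).
- by move=> *; exact: (pcompA H).
- by move=> *; exact: (pcomp_idl H).
- by move=> *; exact: (pcomp_idr H).
- by move=> *; exact: (ptens_comp H).
- by move=> *; exact: (ptensA H).
- by move=> *; exact: (ptens_idl H).
- by move=> *; exact: (ptens_idr H).
- by move=> *; exact: (pperm_comp H).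
- by move=> *; exact: (pperm_tens H).
- by move=> *; exact: (pbraid_nat H).
Qed.

Definition resP (P : prop (fps K)) : prop K := PropPack (resP_is_prop P).

Definition res_mor (P P' : prop (fps K)) (F : mor P P') : mor (resP P) (resP P').
Proof.
refine (@Mor K (resP P) (resP P') (fun n m (f : P n m) => F n m f) _ _ _ _).
- by move=> *; exact: (mor_lin F).
- by move=> *; exact: (mor_perm F).
- by move=> *; exact: (mor_comp F).
- by move=> *; exact: (mor_tens F).
Defined.

Definition modh (P : prop (fps K)) : prop K := resP (quotP (hideal P 1)).

Definition modh_class (P : prop (fps K)) n m (f : P n m) : modh P n m :=
  quot_mor (hideal P 1) n m f.

Lemma mor_hideal (P P' : prop (fps K)) (F : mor P P') k n m (f : P n m) :
  hideal P k n m f -> hideal P' k n m (F n m f).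
Proof.
by move=> [g ->]; exists (F n m g); rewrite morZ. Qed.

Definition modh_mor (P P' : prop (fps K)) (F : mor P P') :
    mor (modh P) (modh P') :=
  res_mor (quot_map (@mor_hideal P P' F 1)).

Lemma modh_mor_class (P P' : prop (fps K)) (F : mor P P') n m (f : P n m) :
  modh_mor F n m (modh_class f) = modh_class (F n m f).
Proof. exact: quot_map_pi. Qed.

Lemma modh_ind (P : prop (fps K)) n m (Q : modh P n m -> Prop) :
  (forall f, Q (modh_class f)) -> forall g, Q g.
Proof. exact: quot_mor_ind. Qed.

Lemma modh_mor_id (P : prop (fps K)) : modh_mor (mor_id P) = mor_id (modh P).
Proof.
apply: mor_ext => n m; elim/modh_ind => f.
by rewrite modh_mor_class.
Qed.

Lemma modh_mor_o (P P' P'' : prop (fps K)) (F : mor P' P'') (G : mor P P') :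
  modh_mor (mor_o F G) = mor_o (modh_mor F) (modh_mor G).
Proof.
apply: mor_ext => n m; elim/modh_ind => f.
by rewrite modh_mor_class !mor_oE !modh_mor_class.
Qed.

(* The identification of P[[h]] / (h) with P: evaluation at h = 0. *)
Section Ev0.
Variable P : prop K.

Definition ev0_fun n m (f : modh (fpsP P) n m) : P n m :=
  (qrepr (f : quotP (hideal (fpsP P) 1) n m) : fps (P n m)) 0%N.

Lemma ev0_class n m (f : fpsP P n m) : ev0_fun (modh_class f) = f 0%N.
Proof.
have [g] : hideal (fpsP P) 1 n m
    (qrepr (quot_mor (hideal (fpsP P) 1) n m f) - f)
  by exact: (@qreprP _ _ (ideal_submod (hideal (fpsP P) 1) n m) f).
move=> /(congr1 (fun u : fps (P n m) => u 0%N)) e.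
apply/eqP; rewrite -subr_eq0; apply/eqP; rewrite [LHS]e.
rewrite expr1 /GRing.scale /= /fps_scale /fps_conv big_ord1.
exact: scale0r.
Qed.

Definition ev0 : mor (modh (fpsP P)) P.
Proof.
exists ev0_fun.
- move=> n m a; elim/modh_ind=> f; elim/modh_ind=> g.
  have -> : a *: modh_class f + modh_class g
            = modh_class ((fps_cst a : fps K) *: f + g).
    by rewrite /modh_class mor_lin.
  by rewrite !ev0_class fps_addE /GRing.scale /= /fps_scale /fps_conv big_ord1.
- by move=> n s; rewrite -[RHS](ev0_class (pperm (fpsP P) s)).
- move=> n m l; elim/modh_ind=> f; elim/modh_ind=> g.
  have -> : modh_class f \oo modh_class g = modh_class (f \oo g).
    by rewrite /modh_class mor_comp.
  by rewrite !ev0_class /= /fps_conv big_ord1.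
- move=> n m n' m'; elim/modh_ind=> f; elim/modh_ind=> g.
  have -> : modh_class f \ox modh_class g = modh_class (f \ox g).
    by rewrite /modh_class mor_tens.
  by rewrite !ev0_class /= /fps_conv big_ord1.
Defined.

End Ev0.

End HAdic.

(* [plit n [:: i_1; ...; i_n]] is the permutation (i_1 ... i_n), a |-> i_a,   *)
(* written with indices starting from 1.                                      *)
Definition plit n (s : seq nat) : 'S_n :=
  insubd (1%g : 'S_n) [ffun i : 'I_n => insubd i (nth 0 s i).-1].

Lemma plitE n (s : seq nat) (i : 'I_n) :
  perm_eq s (iota 1 n) -> plit n s i = (nth 0 s i).-1 :> nat.
Proof.
move=> sn; have szs : size s = n by rewrite (perm_size sn) size_iota.
have us : uniq s by rewrite (perm_uniq sn) iota_uniq.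
have sP (j : 'I_n) : (0 < nth 0 s j <= n)%N.
  have : nth 0%N s j \in iota 1 n.
    by rewrite -(perm_mem sn) mem_nth // szs.
  by rewrite mem_iota add1n ltnS.
have vE (j : 'I_n) : val (insubd j (nth 0%N s j).-1 : 'I_n) = (nth 0%N s j).-1.
  by rewrite val_insubd; case/andP: (sP j); case: (nth 0%N s j) => // k _ ->.
rewrite /plit /insubd insubT => [|inj_s].
  apply/injectiveP => j k; rewrite !ffunE => /(congr1 val); rewrite !vE.
  case/andP: (sP j) => sj _; case/andP: (sP k) => sk _.
  move=> /(congr1 S); rewrite !prednK // => /eqP.
  by rewrite nth_uniq ?szs // => /eqP /val_inj.
by rewrite /= -pvalE /= ffunE vE.
Qed.

Record bialg_ops (R : comNzRingType) (P : preprop R) := BialgOps {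
  bmul : P 2 1;
  bcomul : P 1 2;
  bunit : P 0 1;
  bcounit : P 1 0 }.

Definition map_ops (R : comNzRingType) (P P' : preprop R) (F : mor P P')
    (b : bialg_ops P) : bialg_ops P' :=
  BialgOps (F _ _ (bmul b)) (F _ _ (bcomul b)) (F _ _ (bunit b))
    (F _ _ (bcounit b)).

Section Relations.
Variables (R : comNzRingType) (P : preprop R) (b : bialg_ops P).
Local Notation m := (bmul b).
Local Notation D := (bcomul b).
Local Notation eta := (bunit b).
Local Notation eps := (bcounit b).
Local Notation id1 := (pid P 1).
Local Notation "''p' s" := (pperm P (plit _ s)) (at level 8, s at level 0).

(* A relation x = y is represented by the element x - y of the ideal that it  *)
(* generates.                                                                 *)
Inductive bialg_rel : family P :=
| rel_mulA : bialg_rel (m \oo (m \ox id1) - m \oo (id1 \ox m))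
| rel_mul1l : bialg_rel (m \oo (eta \ox id1) - id1)
| rel_mul1r : bialg_rel (m \oo (id1 \ox eta) - id1)
| rel_comulA : bialg_rel ((D \ox id1) \oo D - (id1 \ox D) \oo D)
| rel_counitl : bialg_rel ((eps \ox id1) \oo D - id1)
| rel_counitr : bialg_rel ((id1 \ox eps) \oo D - id1)
| rel_comul_mul : bialg_rel
    (D \oo m - (m \ox m) \oo 'p [:: 1; 3; 2; 4]%N \oo (D \ox D))
| rel_comul_unit : bialg_rel (D \oo eta - eta \ox eta)
| rel_counit_mul : bialg_rel (eps \oo m - eps \ox eps)
| rel_counit_unit : bialg_rel (eps \oo eta - pid P 0).

Inductive coPoisson_rel (delta : P 1 2) : family P :=
| rel_coco : coPoisson_rel delta (D - 'p [:: 2; 1]%N \oo D)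
| rel_anti : coPoisson_rel delta (delta + 'p [:: 2; 1]%N \oo delta)
| rel_coJacobi : coPoisson_rel delta
    (('p [:: 1; 2; 3]%N + 'p [:: 2; 3; 1]%N + 'p [:: 3; 1; 2]%N)
       \oo (delta \ox id1) \oo delta)
| rel_coLeibniz : coPoisson_rel delta
    ((D \ox id1) \oo delta
     - ('p [:: 1; 2; 3]%N + 'p [:: 2; 1; 3]%N) \oo (id1 \ox delta) \oo D)
| rel_delta_mul : coPoisson_rel delta
    (delta \oo m
     - (m \ox m) \oo 'p [:: 1; 3; 2; 4]%N \oo (delta \ox D + D \ox delta))
| rel_delta_unit : coPoisson_rel delta (delta \oo eta)
| rel_counit_delta : coPoisson_rel delta ((eps \ox id1) \oo delta).

(* iter_comul 1 = (id \ox eps) \oo D, which is the identity in a bialgebra. *)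
Fixpoint iter_comul n : P 1 n :=
  if n is k.+1 then (id1 \ox iter_comul k) \oo D else eps.

Fixpoint tens_pow (f : P 1 1) n : P n n :=
  if n is k.+1 then f \ox tens_pow f k else pid P 0.

Inductive conil_family n : family P :=
| Conil p : (n <= p)%N ->
    conil_family n (tens_pow (id1 - eta \oo eps) p \oo iter_comul p).

Lemma conil_family_decr n : family_sub (conil_family n.+1) (conil_family n).
Proof. by move=> _ _ _ [p /ltnW]; exact: Conil. Qed.

End Relations.

Inductive qcoco_rel (K : comNzRingType) (P : preprop (fps K))
    (b : bialg_ops P) (delta : P 1 2) : family P :=
| rel_qcoco : qcoco_rel b delta
    (bcomul b - pperm P (plit _ [:: 2; 1]%N) \oo bcomul b - hbar K *: delta).

Inductive bialg_gen : nat -> nat -> Type :=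
| gen_mul : bialg_gen 2 1
| gen_comul : bialg_gen 1 2
| gen_unit : bialg_gen 0 1
| gen_counit : bialg_gen 1 0.

Inductive delta_gen : nat -> nat -> Type :=
| gen_delta : delta_gen 1 2.

Section Props.
Variable K : comNzRingType.

Definition free_bialg_ops : bialg_ops (freeP K bialg_gen) :=
  BialgOps (free_gen K gen_mul) (free_gen K gen_comul) (free_gen K gen_unit)
    (free_gen K gen_counit).

Definition Bialg : prop K := quotP (gen_ideal (bialg_rel free_bialg_ops)).
Definition Bialg_ops : bialg_ops Bialg := map_ops (quot_mor _) free_bialg_ops.

Definition Bialg_delta : prop K := adjoin Bialg delta_gen.
Definition Bialg_delta_rel : family Bialg_delta :=
  coPoisson_rel (map_ops (adjoin_old Bialg delta_gen) Bialg_ops)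
    (adjoin_new Bialg gen_delta).

Definition BialgcP : prop K := quotP (gen_ideal Bialg_delta_rel).
Definition BialgcP_ops : bialg_ops BialgcP :=
  map_ops (mor_o (quot_mor _) (adjoin_old Bialg delta_gen)) Bialg_ops.
Definition BialgcP_delta : BialgcP 1 2 :=
  quot_mor (gen_ideal Bialg_delta_rel) _ _ (adjoin_new Bialg gen_delta).

Definition J_ideal n : ideal BialgcP :=
  gen_ideal (conil_family BialgcP_ops n).
Lemma J_decr n : family_sub (J_ideal n.+1) (J_ideal n).
Proof.
move=> p q f Jf I HI SI; apply: (Jf I HI) => r s g /conil_family_decr.
exact: SI.
Qed.
Definition J_filt : filtration BialgcP := Filtration J_decr.

Definition UEcP : prop K := completion J_filt.
Definition UEcP_ops : bialg_ops UEcP := map_ops (comp_in J_filt) BialgcP_ops.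
Definition UEcP_delta : UEcP 1 2 := comp_in J_filt _ _ BialgcP_delta.

Definition fps_ops (P : prop K) (b : bialg_ops P) : bialg_ops (fpsP P) :=
  @BialgOps (fps K) (fpsP P) (fps_cst (bmul b)) (fps_cst (bcomul b))
    (fps_cst (bunit b)) (fps_cst (bcounit b)).

(* Bialg[[h]]<delta>; the h-adic completion expresses that the adjunction     *)
(* takes place among complete K[[h]]-modules.                                 *)
Definition Bialgh_delta : prop (fps K) :=
  hcompletion (adjoin (fpsP Bialg) delta_gen).
Definition Bialgh_delta_ops : bialg_ops Bialgh_delta :=
  map_ops (mor_o (comp_in _) (adjoin_old (fpsP Bialg) delta_gen))
    (fps_ops Bialg_ops).
Definition Bialgh_delta_new : Bialgh_delta 1 2 :=
  comp_in (hfilt (adjoin (fpsP Bialg) delta_gen)) _ _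
    (adjoin_new (fpsP Bialg) gen_delta).

Definition qcoco_ideal : ideal Bialgh_delta :=
  gen_hideal (qcoco_rel Bialgh_delta_ops Bialgh_delta_new).
Definition Bialgh_qcoco : prop (fps K) := quotP qcoco_ideal.

Definition torsion_ideal : ideal Bialgh_qcoco :=
  gen_hideal (torsion (P := Bialgh_qcoco)).

Definition Bialgqcoco : prop (fps K) := quotP torsion_ideal.
Definition Bialgqcoco_ops : bialg_ops Bialgqcoco :=
  map_ops (mor_o (quot_mor torsion_ideal) (quot_mor qcoco_ideal))
    Bialgh_delta_ops.
Definition Bialgqcoco_delta : Bialgqcoco 1 2 :=
  quot_mor torsion_ideal _ _ (quot_mor qcoco_ideal _ _ Bialgh_delta_new).

Definition K_ideal n : ideal Bialgqcoco :=
  gen_hideal (conil_family Bialgqcoco_ops n).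
Lemma K_decr n : family_sub (K_ideal n.+1) (K_ideal n).
Proof.
move=> p q f Kf I HI [cI SI]; apply: (Kf I HI); split=> // r s g.
by move=> /conil_family_decr; exact: SI.
Qed.
Definition K_filt : filtration Bialgqcoco := Filtration K_decr.

Definition QUE : prop (fps K) := completion K_filt.
Definition QUE_ops : bialg_ops QUE := map_ops (comp_in K_filt) Bialgqcoco_ops.
Definition QUE_delta : QUE 1 2 := comp_in K_filt _ _ Bialgqcoco_delta.

Definition modh_ops (P : prop (fps K)) (b : bialg_ops P) :
    bialg_ops (modh P) :=
  @BialgOps K (modh P) (modh_class (bmul b)) (modh_class (bcomul b))
    (modh_class (bunit b)) (modh_class (bcounit b)).

(* SC is induced by its values on generators: it is continuous for the        *)
(* filtrations by the kernels of UEcP -> BialgcP / J_l and by the images of   *)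
(* the kernels of QUE -> Bialgqcoco / K_k.                                    *)
Record is_semiclassical (SC : mor UEcP (modh QUE)) : Prop := IsSemiclassical {
  sc_ops : map_ops SC UEcP_ops = modh_ops QUE_ops;
  sc_delta : SC _ _ UEcP_delta = modh_class QUE_delta;
  sc_cont : forall k, exists l, forall n m (f : UEcP n m),
    comp_proj J_filt l n m f = 0 ->
    exists g : QUE n m, comp_proj K_filt k n m g = 0 /\ SC n m f = modh_class g }.

Definition is_quantization (SC : mor UEcP (modh QUE))
    (Q : mor QUE (fpsP UEcP)) : Prop :=
  mor_o (mor_o (ev0 UEcP) (modh_mor Q)) SC = mor_id UEcP.

End Props.

Record aut1 (K : comNzRingType) (P : prop (fps K)) := Aut1 {
  aut_mor :> mor P P;
  aut_iso : is_iso aut_mor;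
  aut_mod : modh_mor aut_mor = mor_id (modh P) }.

Section Aut1.
Variables (K : comNzRingType) (P : prop (fps K)).

HB.instance Definition _ := gen_eqMixin (aut1 P).
HB.instance Definition _ := gen_choiceMixin (aut1 P).

Lemma aut1_ext (F G : aut1 P) : aut_mor F = aut_mor G -> F = G.
Proof.
case: F G => [F F1 F2] [G G1 G2] /= e; case: _ / e G1 G2 => G1 G2.
by congr Aut1; exact: Prop_irrelevance.
Qed.

Definition aut1_one : aut1 P.
Proof.
exists (mor_id P); last exact: modh_mor_id.
by exists (mor_id P); rewrite mor_o_idl.
Defined.

Definition aut1_mul (F G : aut1 P) : aut1 P.
Proof.
exists (mor_o F G).
  have [F' [F1 F2]] := aut_iso F; have [G' [G1 G2]] := aut_iso G.
  exists (mor_o G' F'); split.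
    by rewrite mor_oA -(mor_oA G') F1 mor_o_idr.
  by rewrite mor_oA -(mor_oA F) G2 mor_o_idr.
by rewrite modh_mor_o !aut_mod mor_o_idl.
Defined.

Lemma aut1_inv_subproof (F : aut1 P) : exists G : aut1 P,
  mor_o G F = mor_id P /\ mor_o F G = mor_id P.
Proof.
have [G [G1 G2]] := aut_iso F.
have G_iso : is_iso G by exists F.
have G_mod : modh_mor G = mor_id (modh P).
  have := congr1 (@modh_mor K P P) G1.
  by rewrite modh_mor_o aut_mod mor_o_idr modh_mor_id.
by exists (Aut1 G_iso G_mod).
Qed.

Definition aut1_inv (F : aut1 P) : aut1 P := sval (cid (aut1_inv_subproof F)).

Let mulA : associative aut1_mul.
Proof. by move=> F G H; apply: aut1_ext; exact: mor_oA. Qed.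
Let mul1 : left_id aut1_one aut1_mul.
Proof. by move=> F; apply: aut1_ext; exact: mor_o_idl. Qed.
Let mulr1 : right_id aut1_one aut1_mul.
Proof. by move=> F; apply: aut1_ext; exact: mor_o_idr. Qed.
Let mulV : left_inverse aut1_one aut1_inv aut1_mul.
Proof.
by move=> F; apply: aut1_ext; case: (svalP (cid (aut1_inv_subproof F))).
Qed.
Let mulrV : right_inverse aut1_one aut1_inv aut1_mul.
Proof.
by move=> F; apply: aut1_ext; case: (svalP (cid (aut1_inv_subproof F))).
Qed.

HB.instance Definition _ := isGroup.Build (aut1 P) mulA mul1 mulr1 mulV mulrV.

End Aut1.

Record is_right_torsor (G : groupType) (X : Type) (act : X -> G -> X) : Prop :=
  IsRightTorsor {
  rtorsor_inh : inhabited X;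
  rtorsor_act1 : forall x, act x 1%g = x;
  rtorsor_actM : forall x g h, act (act x g) h = act x (g * h)%g;
  rtorsor_uniq : forall x y, exists! g, act x g = y }.

Record is_left_torsor (G : groupType) (X : Type) (act : G -> X -> X) : Prop :=
  IsLeftTorsor {
  ltorsor_inh : inhabited X;
  ltorsor_act1 : forall x, act 1%g x = x;
  ltorsor_actM : forall g h x, act g (act h x) = act (g * h)%g x;
  ltorsor_uniq : forall x y, exists! g, act g x = y }.

Record quantization (K : comNzRingType) (SC : mor (UEcP K) (modh (QUE K))) :=
  Quantization {
  quant_mor :> mor (QUE K) (fpsP (UEcP K));
  quantP : is_quantization SC quant_mor }.

Section Actions.
Variables (K : comNzRingType) (SC : mor (UEcP K) (modh (QUE K))).

Definition quant_ract (Q : quantization SC) (g : aut1 (QUE K)) :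
  quantization SC.
Proof.
exists (mor_o Q g); rewrite /is_quantization modh_mor_o aut_mod mor_o_idr.
exact: quantP.
Defined.

Definition quant_lact (g : aut1 (fpsP (UEcP K))) (Q : quantization SC) :
  quantization SC.
Proof.
exists (mor_o g Q); rewrite /is_quantization modh_mor_o aut_mod mor_o_idl.
exact: quantP.
Defined.

End Actions.

(* Main.v *)
(* Let M be Bialgqcoco, so that QUE is the limit of the M / K_k. All these    *)
(* modules are h-adically complete and separated, and UEcP[[h]] is moreover   *)
(* torsion-free; hence Q is bijective as soon as Q mod h is, and since        *)
(* (Q mod h) o SC = id this amounts to the surjectivity of SC. As Bialgqcoco  *)
(* is generated modulo h by the images of the generators of BialgcP, the      *)
(* image of SC is dense, and the point is that h QUE is closed in QUE for the *)
(* topology given by (K_k), although M / K_k may have h-torsion. The given Q  *)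
(* controls this torsion: it sends the p-th generator of the ideals K_k to an *)
(* element which modulo J_s is divisible by h^N when p >= N s, because the    *)
(* iterated coproduct splits into N blocks of size at least s. Therefore      *)
(* h^N x in K_l with l >= (N + 1) s forces x in K_s + h M, and by induction   *)
(* on N, h x in K_l with l large forces x in K_s + h^N M. Thus componentwise  *)
(* quotients by h of an element of QUE can be corrected into a compatible     *)
(* family.                                                                    *)

From mathcomp Require Import all_boot all_order all_algebra all_fingroup.
From mathcomp Require Import boolp.
Require Import Defs.

Set Implicit Arguments.
Unset Strict Implicit.
Unset Printing Implicit Defensive.

Import GRing.Theory.
Local Open Scope ring_scope.
Local Open Scope prop_scope.

(** Modulo [h], [Q] is a left inverse of [SC]. Once [SC] is known to be onto ([SC_surj]), the two
    are mutually inverse ([SC_section]), and [hadic_bijective] lifts bijectivity from the reduction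
    to [Q] itself ([quant_bijective]). Moreover all quantization morphisms then have the same
    reduction, the inverse of [SC] ([quant_modh_uniq]), so that both Q^-1 Q' and Q' Q^-1 reduce to
    the identity; they are the only elements carrying Q to Q' on the right and on the left.

    Surjectivity of [SC] has two halves. Density ([sc_approx]) comes from generators: those of
    [BialgcP] and those of [Bialgqcoco] modulo [h] are matched by [sc_rel], which also matches J_k
    with K_k. Closedness of h QUE ([hQUE_closed]) is the hard half. The h-valuation of [Q] modulo
    J_s is bounded below on K_l ([quant_small_K_ideal]), which gives an Artin-Rees type estimate for
    division by [h] ([K_ideal_hbar]). *)

(** * Complete and separated modules over K[[h]] *)

Section HAdicModules.
Variable K : comNzRingType.
Local Notation h := (hbar K).
Implicit Types V W : lmodType (fps K).

(* [s j] is the sum of the series f_j + h f_{j+1} + h^2 f_{j+2} + ... *)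
Definition hsums V (f s : nat -> V) : Prop :=
  forall j, s j = f j + h *: s j.+1.

(** Completeness without limits: a sum comes with all its tails, and in a separated module the
    recursion determines them ([hsums_uniq]). *)
Definition hcomplete V : Prop := forall f : nat -> V, exists s, hsums f s.

Definition hseparated V : Prop :=
  forall x : V, (forall k, exists y, x = h ^+ k *: y) -> x = 0.

Lemma hsumsX V (f s : nat -> V) k :
  hsums f s -> s 0 = \sum_(i < k) h ^+ i *: f i + h ^+ k *: s k.
Proof.
move=> fs; elim: k => [|k ->]; first by rewrite big_ord0 add0r scale1r.
by rewrite big_ord_recr /= -addrA {1}(fs k) scalerDr scalerA -exprSr.
Qed.

(** Each [d j] is h^k times [d (j + k)] for every k. Applied to differences of tails, this replaces
    convergence arguments. *)
Lemma hdiv_eq0 V (d : nat -> V) :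
  hseparated V -> (forall j, d j = h *: d j.+1) -> forall j, d j = 0.
Proof.
move=> sep dS j; apply: sep => k; exists (d (j + k)%N).
elim: k => [|k ->]; first by rewrite addn0 scale1r.
by rewrite addnS dS scalerA -exprSr.
Qed.

Lemma hsums_uniq V (f s s' : nat -> V) :
  hseparated V -> hsums f s -> hsums f s' -> s =1 s'.
Proof.
move=> sep fs fs' j; apply/eqP; rewrite -subr_eq0; apply/eqP.
apply: (@hdiv_eq0 V (fun j => s j - s' j)) => // i.
by rewrite {1}fs {1}fs' opprD addrACA subrr add0r scalerBr.
Qed.

Lemma hsums_map V W (L : V -> W) (f s : nat -> V) :
  (forall a x y, L (a *: x + y) = a *: L x + L y) ->
  hsums f s -> hsums (L \o f) (L \o s).
Proof. by move=> lin fs j; rewrite /= {1}fs addrC lin addrC. Qed.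

Lemma hcomplete_surj V W (L : V -> W) :
  (forall a x y, L (a *: x + y) = a *: L x + L y) ->
  (forall y, exists x, L x = y) -> hcomplete V -> hcomplete W.
Proof.
move=> lin surj cV f; have [g gP] := choice (fun j => surj (f j)).
have [s gs] := cV g; exists (L \o s) => j.
by rewrite -gP; exact: (hsums_map lin gs).
Qed.

Section Limit.
Variables (M : nat -> lmodType (fps K)) (t : forall n, M n.+1 -> M n).
Hypothesis t_lin : forall n a x y, t (a *: x + y) = a *: t x + t y :> M n.
Hypothesis sepM : forall n, hseparated (M n).

Lemma lim_hseparated : hseparated (limmod t_lin).
Proof.
move=> x xP; apply: lim_ext => n; apply: sepM => k.
by have [y ->] := xP k; exists (y n).
Qed.

(** Sums are taken componentwise; their uniqueness in the separated [M n] makes them compatible with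
    [t]. *)
Lemma lim_hcomplete : (forall n, hcomplete (M n)) -> hcomplete (limmod t_lin).
Proof.
move=> cM f; pose cf n := cid (cM n (fun j => f j n)).
pose s n := sval (cf n); have sP n : hsums (fun j => f j n) (s n).
  exact: svalP (cf n).
have s_compat j : limcompat t (fun n => s n j).
  move=> n; have sn : hsums (fun j => f j n) (fun j => t (s n.+1 j)).
    move=> i; have := hsums_map (@t_lin n) (sP n.+1) i.
    by rewrite /= (limvalP (f i)).
  exact: (hsums_uniq (@sepM n) sn (sP n)).
exists (fun j => LimMod t_lin (s_compat j)) => j.
by apply: lim_ext => n; exact: sP.
Qed.

End Limit.

(** The last two hypotheses say that [L] modulo [h] is onto and one-to-one; successive approximation
    does the rest. *)
Lemma hadic_bijective V W (L : V -> W) :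
  (forall a x y, L (a *: x + y) = a *: L x + L y) ->
  hcomplete V -> hseparated V -> hseparated W ->
  (forall w : W, h *: w = 0 -> w = 0) ->
  (forall w, exists v w', w = L v + h *: w') ->
  (forall v w, L v = h *: w -> exists v', v = h *: v') ->
  bijective L.
Proof.
move=> lin cV sV sW tfW surj inj.
have LD x y : L (x + y) = L x + L y by have := lin 1 x y; rewrite !scale1r.
have L0 : L 0 = 0 by apply: (addrI (L 0)); rewrite -LD !addr0.
have LZ a x : L (a *: x) = a *: L x by have := lin a x 0; rewrite L0 !addr0.
have inj0 v : L v = 0 -> v = 0.
  move=> Lv; apply: sV => k.
  (* The quotient stays in the kernel because [W] has no h-torsion, so division by [h] can be
     repeated. *)
  suff [v' [-> _]] : exists v', v = h ^+ k *: v' /\ L v' = 0 by exists v'.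
  elim: k => [|k [u [-> Lu]]]; first by exists v; rewrite scale1r.
  have [|u' eu] := inj u 0; first by rewrite Lu scaler0.
  exists u'; rewrite exprSr -scalerA -eu; split=> //.
  by apply: tfW; rewrite -LZ -eu.
have injL : injective L.
  move=> x y e; apply/eqP; rewrite -subr_eq0; apply/eqP/inj0.
  by rewrite LD -scaleN1r LZ scaleN1r e subrr.
have surjL w : exists v, L v = w.
  have [v vP] := choice surj; have [r rP] := choice vP.
  (* [r] is the error of one approximation divided by [h]. The preimage of [w] is the sum of the h^j
     [v (wn j)], whose tail [s j] is sent to [wn j]. *)
  pose wn n := iter n r w.
  have [s sP] := cV (v \o wn); exists (s 0).
  apply/eqP; rewrite -subr_eq0; apply/eqP.
  apply: (@hdiv_eq0 W (fun j => L (s j) - wn j)) => // j.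
  have /= Ls := hsums_map lin sP j.
  by rewrite /= {1}(rP (wn j)) Ls opprD addrACA subrr add0r scalerBr.
have [g gP] := choice surjL.
by exists g => // x; apply: injL; rewrite gP.
Qed.

End HAdicModules.

(** * Multiplication by [h] on formal series *)

Section Series.
Variables (K : comNzRingType) (V : lmodType K).
Local Notation h := (hbar K).

Definition fps_shift (f : fps V) : fps V := fun n => f n.+1.

Lemma fps_cst_scale (a : K) (f : fps V) n :
  ((fps_cst a : fps K) *: f) n = a *: f n.
Proof.
rewrite /GRing.scale /= /fps_scale /fps_conv big_ord_recl subn0 big1 ?addr0 //.
by move=> i _; rewrite /fps_cst /fps_mono /= scale0r.
Qed.

Lemma hbar_scale0 (f : fps V) : (h *: f) 0%N = 0.
Proof.
by rewrite /GRing.scale /= /fps_scale /fps_conv big_ord1 /= scale0r.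
Qed.

Lemma hbar_scaleS (f : fps V) n : (h *: f) n.+1 = f n.
Proof.
rewrite /GRing.scale /= /fps_scale /fps_conv big_ord_recl [X in X + _]scale0r.
rewrite add0r big_ord_recl /= subSS subn0 [hbar _ _]/= scale1r big1 ?addr0 //.
by move=> i _; rewrite /hbar /fps_mono /= scale0r.
Qed.

Lemma hbarX_scale (f : fps V) k n : (h ^+ k *: f) (k + n)%N = f n.
Proof.
elim: k => [|k IH]; first by rewrite scale1r.
by rewrite exprS -scalerA addSn hbar_scaleS.
Qed.

Lemma hbarX_scale_lt (f : fps V) k n : (n < k)%N -> (h ^+ k *: f) n = 0.
Proof.
elim: k n => // k IH [|n]; rewrite exprS -scalerA ?hbar_scale0 //.
by rewrite hbar_scaleS; exact: IH.
Qed.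

Lemma fps_decomp (f : fps V) : f = fps_cst (f 0%N) + h *: fps_shift f.
Proof.
apply: funext => -[|n]; rewrite fps_addE ?hbar_scale0 ?addr0 //.
by rewrite hbar_scaleS add0r.
Qed.

Lemma fps_hseparated : hseparated (fps V : lmodType (fps K)).
Proof.
move=> x xP; apply: funext => n; have [y ->] := xP n.+1.
exact: hbarX_scale_lt.
Qed.

Lemma fps_hbar_eq0 (f : fps V) : h *: f = 0 -> f = 0.
Proof.
by move=> e; apply: funext => n; rewrite -(hbar_scaleS f) e.
Qed.

End Series.

(** * Separatedness and completeness of quotients and completions of props *)

Section HAdicProps.
Variable K : comNzRingType.
Local Notation h := (hbar K).
Implicit Types P : prop (fps K).

Lemma gen_hideal_closed P (S : family P) : hclosed (gen_hideal S).
Proof.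
move=> n m f fP I HI [cI SI]; apply: (cI) => k; have [g [Sg fg]] := fP k.
by exists g; split=> //; exact: Sg.
Qed.

Lemma hideal_closed P k : hclosed (hideal P k).
Proof.
move=> n m f /(_ k) [_ [[g ->] [g' e]]]; exists (g + g').
by rewrite scalerDr -e addrC subrK.
Qed.

(** If the class of [f] is divisible by h^k, then [f] agrees with an element of [I] up to h^k;
    closedness concludes. *)
Lemma quotP_hseparated P (I : ideal P) n m :
  hclosed I -> hseparated (quotP I n m).
Proof.
move=> cI; elim/quot_mor_ind => f fP.
rewrite -(mor0 (quot_mor I)); apply/quot_morP; rewrite subr0.
apply: cI => k; have [y] := fP k; elim/quot_mor_ind: y => g.
rewrite -morZ => /quot_morP Ifg; exists (f - h ^+ k *: g); split=> //.
by exists g; rewrite opprB addrC subrK.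
Qed.

Lemma quotP_hcomplete P (I : ideal P) n m :
  hcomplete (P n m) -> hcomplete (quotP I n m).
Proof.
apply: (@hcomplete_surj K (P n m) (quotP I n m) (quot_mor I n m)).
  exact: mor_lin.
by elim/quot_mor_ind=> f; exists f.
Qed.

(** As h^k acts by zero, series are truncated to k terms; the vanishing term of index k is what
    allows the shift in the recursion. *)
Lemma quot_hideal_hcomplete P k n m : hcomplete (quotP (hideal P k) n m).
Proof.
move=> f; have hk0 (x : quotP (hideal P k) n m) : h ^+ k *: x = 0.
  elim/quot_mor_ind: x => x; rewrite -morZ -(mor0 (quot_mor (hideal P k))).
  by apply/quot_morP; rewrite subr0; exists x.
exists (fun j => \sum_(i < k) h ^+ i *: f (j + i)%N) => j.
have -> : \sum_(i < k) h ^+ i *: f (j + i)%N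
          = \sum_(i < k.+1) h ^+ i *: f (j + i)%N.
  by rewrite big_ord_recr /= hk0 addr0.
rewrite big_ord_recl /= scale1r addn0 scaler_sumr; congr (_ + _).
by apply: eq_bigr => i _; rewrite scalerA -exprS addSnnS.
Qed.

Lemma completion_hseparated P (I : filtration P) n m :
  (forall k, hclosed (I k)) -> hseparated (completion I n m).
Proof. by move=> cI; apply: lim_hseparated => k; exact: quotP_hseparated. Qed.

Lemma completion_hcomplete P (I : filtration P) n m :
  (forall k, hclosed (I k)) -> (forall k, hcomplete (quotP (I k) n m)) ->
  hcomplete (completion I n m).
Proof. by move=> cI; apply: lim_hcomplete => k; exact: quotP_hseparated. Qed.

Lemma hcompletion_hcomplete P n m : hcomplete (hcompletion P n m).
Proof.
apply: completion_hcomplete => k; first exact: hideal_closed.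
exact: quot_hideal_hcomplete.
Qed.

End HAdicProps.

(** * Elements of completions as Cauchy sequences *)

Section Completion.
Variables (R : comNzRingType) (P : prop R) (I : filtration P).

Lemma comp_proj_in k n m (f : P n m) :
  comp_proj I k n m (comp_in I n m f) = quot_mor (I k) n m f.
Proof. by []. Qed.

Lemma filt_le j k n m (f : P n m) : (j <= k)%N -> I k n m f -> I j n m f.
Proof.
by move=> /subnK <-; elim: (k - j)%N => // i IH /filt_decr.
Qed.

Lemma comp_in_proj0 k n m (f : P n m) :
  I k n m f <-> comp_proj I k n m (comp_in I n m f) = 0.
Proof.
by rewrite comp_proj_in -(mor0 (quot_mor (I k))) quot_morP subr0.
Qed.

Lemma comp_projS k n m (x : completion I n m) :
  comp_trans I k n m (comp_proj I k.+1 n m x) = comp_proj I k n m x.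
Proof. exact: (limvalP x k). Qed.

Lemma comp_proj0_le j k n m (x : completion I n m) :
  (j <= k)%N -> comp_proj I k n m x = 0 -> comp_proj I j n m x = 0.
Proof.
move=> /subnK <-; elim: (k - j)%N => // i IH x0; apply: IH.
by rewrite -comp_projS x0 mor0.
Qed.

Lemma comp_ext n m (x y : completion I n m) :
  (forall k, comp_proj I k n m x = comp_proj I k n m y) -> x = y.
Proof. exact: lim_ext. Qed.

Lemma comp_proj_rep k n m (x : completion I n m) :
  exists f, comp_proj I k n m x = comp_proj I k n m (comp_in I n m f).
Proof.
elim/quot_mor_ind: (comp_proj I k n m x) => f; exists f.
exact: esym (comp_proj_in k f).
Qed.

Lemma comp_reps n m (x : completion I n m) :
  exists u : nat -> P n m,
    (forall k, comp_proj I k n m x = comp_proj I k n m (comp_in I n m (u k))) /\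
    (forall k, I k n m (u k.+1 - u k)).
Proof.
have [u uP] := choice (fun k => comp_proj_rep k x).
exists u; split=> // k; apply/comp_in_proj0; rewrite !morB -uP.
apply/eqP; rewrite subr_eq0; apply/eqP.
by rewrite -(comp_projS k x) uP !comp_proj_in quot_map_pi.
Qed.

Lemma comp_lim n m (u : nat -> P n m) :
  (forall k, I k n m (u k.+1 - u k)) ->
  exists x : completion I n m,
    forall k, comp_proj I k n m x = comp_proj I k n m (comp_in I n m (u k)).
Proof.
move=> uP.
have xP : limcompat (fun k => comp_trans I k n m)
    (fun k => quot_mor (I k) n m (u k)).
  by move=> k; rewrite quot_map_pi; apply/quot_morP; exact: uP.
by exists (LimMod (fun k => @mor_lin _ _ _ (comp_trans I k) n m) xP).
Qed.

End Completion.

Section HCompletion.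
Variables (K : comNzRingType) (P : prop (fps K)).
Local Notation h := (hbar K).

(** Successive representatives differ by h^k b_k, so [x] is u_0 plus the sum of the h^k b_k; [a]
    keeps the terms without a factor [h]. *)
Lemma hcompletion_approx n m (x : hcompletion P n m) :
  exists a y, x = comp_in (hfilt P) n m a + h *: y.
Proof.
have [u [ux uP]] := comp_reps x.
have [b bP] := choice uP.
have [s sP] :=
  @hcompletion_hcomplete K P n m (fun k => comp_in (hfilt P) n m (b k)).
exists (u 0%N + b 0%N), (s 1%N).
rewrite (morD (comp_in (hfilt P))) -addrA -(sP 0%N); apply: comp_ext => k.
rewrite ux (hsumsX k sP) addrA morD [X in _ = _ + X](_ : _ = 0).
  rewrite addr0; congr (comp_proj _ _ _ _ _); elim: k => [|k IH].
    by rewrite big_ord0 addr0.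
  have eu : u k.+1 = u k + h ^+ k *: b k by rewrite -bP addrC subrK.
  rewrite big_ord_recr addrA -IH eu.
  by rewrite (morD (comp_in (hfilt P))) (morZ (comp_in (hfilt P))).
rewrite morZ; elim/quot_mor_ind: (comp_proj (hfilt P) k n m (s k)) => g.
rewrite -morZ -(mor0 (quot_mor (hideal P k))); apply/quot_morP; rewrite subr0.
by exists g.
Qed.

End HCompletion.

(** * Induction on generators of a prop *)

Section Subprops.
Variable R : comNzRingType.

Record is_subprop (P : preprop R) (X : family P) : Prop := IsSubprop {
  subprop0 : forall n m, X n m 0;
  subprop_lin : forall n m a (f g : P n m),
    X n m f -> X n m g -> X n m (a *: f + g);
  subprop_perm : forall n s, X n n (pperm P s);
  subprop_comp : forall n m l (f : P m l) (g : P n m),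
    X m l f -> X n m g -> X n l (f \oo g);
  subprop_tens : forall n m n' m' (f : P n m) (g : P n' m'),
    X n m f -> X n' m' g -> X _ _ (f \ox g) }.

Lemma subprop_preim (P P' : preprop R) (F : mor P P') (X : family P') :
  is_subprop X -> is_subprop (fun n m f => X n m (F n m f)).
Proof.
move=> HX; split.
- by move=> n m; rewrite mor0; exact: subprop0.
- by move=> n m a f g Xf Xg; rewrite mor_lin; exact: subprop_lin.
- by move=> n s; rewrite mor_perm; exact: subprop_perm.
- by move=> n m l f g Xf Xg; rewrite mor_comp; exact: subprop_comp.
- by move=> n m n' m' f g Xf Xg; rewrite mor_tens; exact: subprop_tens.
Qed.

Lemma free_subprop (G : nat -> nat -> Type) (X : family (freeP R G)) :
  is_subprop X ->
  (forall n m (x : G n m), X n m (free_gen R x)) ->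
  forall n m x, X n m x.
Proof.
move=> HX XG n m x; have [t <-] := fpi_surj x.
elim: {n m x} t => [n m x|n s|n m l t Xt u Xu|n m n' m' t Xt u Xu|n m
                   |n m t Xt u Xu|n m a t Xt].
- exact: XG.
- exact: (subprop_perm HX).
- have -> : fpi (TComp t u)
      = (fpi t : freeP R G m l) \oo (fpi u : freeP R G n m).
    apply: fhom_ext => P a; rewrite feval_pi.
    by rewrite [RHS](mor_comp (free_eval a)) /= !feval_pi.
  exact: subprop_comp.
- have -> : fpi (TTens t u)
      = (fpi t : freeP R G n m) \ox (fpi u : freeP R G n' m').
    apply: fhom_ext => P a; rewrite feval_pi.
    by rewrite [RHS](mor_tens (free_eval a)) /= !feval_pi.
  exact: subprop_tens.
- exact: (subprop0 HX).
- have -> : fpi (TAdd t u) = 1 *: (fpi t : freeP R G n m) + fpi u.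
    apply: fhom_ext => P a; rewrite feval_pi.
    by rewrite [RHS](mor_lin (free_eval a)) /= !feval_pi scale1r.
  exact: subprop_lin.
- have -> : fpi (TScale a t) = a *: (fpi t : freeP R G n m) + 0.
    apply: fhom_ext => P b; rewrite feval_pi addr0.
    by rewrite [RHS](morZ (free_eval b)) /= !feval_pi.
  by apply: subprop_lin => //; exact: subprop0.
Qed.

Lemma quot_subprop (P : prop R) (I : ideal P) (X : family (quotP I)) :
  (forall n m f, X n m (quot_mor I n m f)) -> forall n m x, X n m x.
Proof. by move=> XI n m; elim/quot_mor_ind. Qed.

Lemma adjoin_subprop (P : prop R) (G : nat -> nat -> Type)
    (X : family (adjoin P G)) :
  is_subprop X ->
  (forall n m f, X n m (adjoin_old P G n m f)) ->
  (forall n m (x : G n m), X n m (adjoin_new P x)) ->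
  forall n m x, X n m x.
Proof.
move=> HX Xold Xnew n m; elim/quot_mor_ind => f; move: n m f.
apply: (free_subprop (subprop_preim (quot_mor _) HX)) => n m [f|x].
- exact: Xold.
- exact: Xnew.
Qed.

End Subprops.

(** * Splitting the generators of J_n and K_n into blocks *)

Section Conil.
Variables (R : comNzRingType) (P : prop R) (b : bialg_ops P).
Local Notation D := (bcomul b).
Local Notation eps := (bcounit b).
Local Notation id1 := (pid P 1).
Hypothesis comulA : (D \ox id1) \oo D = (id1 \ox D) \oo D.
Hypothesis counitl : (eps \ox id1) \oo D = id1.

(** The elements [conil p] with [p] at least k generate J_k, and generate K_k as a closed ideal. *)
Definition conil n : P 1 n :=
  tens_pow (id1 - bunit b \oo eps) n \oo iter_comul b n.

Lemma conil0 : conil 0 = eps.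
Proof. exact: pcomp_idl (propP P) _ _ _. Qed.

Lemma conilS n : conil n.+1 = ((id1 - bunit b \oo eps) \ox conil n) \oo D.
Proof.
set f := id1 - _; have HP := propP P.
have <- : (f \ox tens_pow f n) \oo (id1 \ox iter_comul b n) = f \ox conil n.
  by rewrite -(ptens_comp HP) (pcomp_idr HP).
exact: pcompA HP _ _ _ _ _ _ _.
Qed.

Lemma pcast_id n m (en : n = n) (em : m = m) (f : P n m) : pcast en em f = f.
Proof. by rewrite (eq_irrelevance en erefl) (eq_irrelevance em erefl). Qed.

(** By coassociativity the iterated coproduct can be cut anywhere; the left counit law is the case
    of an empty first block. *)
Lemma conilD p q : conil (p + q) = (conil p \ox conil q) \oo D.
Proof.
have HP := propP P; elim: p => [|p IH].
  have <- : (pid P 0 \ox conil q) \oo (eps \ox id1) = conil 0 \ox conil q.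
    by rewrite -(ptens_comp HP) (pcomp_idl HP) (pcomp_idr HP) conil0.
  rewrite -(pcompA HP) counitl.
  by rewrite (pcomp_idr HP) (ptens_idl HP).
rewrite [LHS]conilS IH conilS; set f := id1 - _.
have -> : f \ox ((conil p \ox conil q) \oo D)
          = (f \ox (conil p \ox conil q)) \oo (id1 \ox D).
  by rewrite -(ptens_comp HP) (pcomp_idr HP).
have -> : ((f \ox conil p) \oo D) \ox conil q
          = ((f \ox conil p) \ox conil q) \oo (D \ox id1).
  by rewrite -(ptens_comp HP) (pcomp_idr HP).
rewrite -(pcompA HP) -comulA (pcompA HP) -[RHS](pcompA HP).
by rewrite (ptensA HP) pcast_id -(pcompA HP).
Qed.

End Conil.

Section Coalg.

Definition coalg_axioms (R : comNzRingType) (P : preprop R) (b : bialg_ops P) :=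
  (bcomul b \ox pid P 1) \oo bcomul b = (pid P 1 \ox bcomul b) \oo bcomul b /\
  (bcounit b \ox pid P 1) \oo bcomul b = pid P 1.

Lemma coalg_axioms_map (R : comNzRingType) (P P' : preprop R) (F : mor P P')
    (b : bialg_ops P) :
  coalg_axioms b -> coalg_axioms (map_ops F b).
Proof.
move=> [A C]; split.
  by rewrite -!(mor_pid F) -!mor_tens -!mor_comp A.
by rewrite -!(mor_pid F) -!mor_tens -!mor_comp C.
Qed.

Lemma fps_cst_comp (K : comNzRingType) (P : prop K) n m l
    (f : P m l) (g : P n m) :
  fps_cst (f \oo g) = (fps_cst f : fpsP P m l) \oo (fps_cst g : fpsP P n m).
Proof.
apply/esym/(@fps_conv_mono (P m l) (P n m) (P n l)).
by split=> x y z; rewrite (pcompDl, pcompDr).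
Qed.

Lemma fps_cst_tens (K : comNzRingType) (P : prop K) n m n' m'
    (f : P n m) (g : P n' m') :
  fps_cst (f \ox g) = (fps_cst f : fpsP P n m) \ox (fps_cst g : fpsP P n' m').
Proof.
apply/esym/(@fps_conv_mono (P n m) (P n' m') (P (n + n')%N (m + m')%N)).
by split=> x y z; rewrite (ptensDl, ptensDr).
Qed.

Lemma coalg_axioms_fps (K : comNzRingType) (P : prop K) (b : bialg_ops P) :
  coalg_axioms b -> coalg_axioms (fps_ops b).
Proof.
move=> [A C].
have tensE n m n' m' (f : P n m) (g : P n' m') (f' : P 1%N (n + n')%N) :
    ((fps_cst f : fpsP P n m) \ox (fps_cst g : fpsP P n' m'))
      \oo (fps_cst f' : fpsP P 1 (n + n')) = fps_cst ((f \ox g) \oo f').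
  by rewrite -fps_cst_tens -fps_cst_comp.
split.
  apply: etrans (tensE _ _ _ _ (bcomul b) (pid P 1) (bcomul b)) _.
  by rewrite A; exact: esym (tensE _ _ _ _ (pid P 1) (bcomul b) (bcomul b)).
apply: etrans (tensE _ _ _ _ (bcounit b) (pid P 1) (bcomul b)) _.
by rewrite C.
Qed.

Lemma coalg_axioms_Bialg (K : comNzRingType) : coalg_axioms (Bialg_ops K).
Proof.
have rel n m (f g : freeP K bialg_gen n m) :
    bialg_rel (free_bialg_ops K) (f - g) ->
    quot_mor (gen_ideal (bialg_rel (free_bialg_ops K))) n m f
    = quot_mor (gen_ideal (bialg_rel (free_bialg_ops K))) n m g.
  by move=> fg; apply/quot_morP => I _; apply.
set q := quot_mor _ in rel; split.
  rewrite -!(mor_pid q) -!(mor_tens q) -!(mor_comp q); apply: rel.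
  exact: rel_comulA.
rewrite -!(mor_pid q) -!(mor_tens q) -!(mor_comp q); apply: rel.
exact: rel_counitl.
Qed.

End Coalg.

(** * Generation of [BialgcP], and of [Bialgqcoco] modulo [h] *)

Section Generation.
Variable K : comNzRingType.

Definition ops_in (R : comNzRingType) (P : preprop R) (X : family P)
    (b : bialg_ops P) : Prop :=
  [/\ X 2%N 1%N (bmul b), X 1%N 2%N (bcomul b), X 0%N 1%N (bunit b)
    & X 1%N 0%N (bcounit b)].

Lemma Bialg_generated (X : family (Bialg K)) :
  is_subprop X -> ops_in X (Bialg_ops K) -> forall n m f, X n m f.
Proof.
move=> HX [Xm XD Xe Xc]; apply: quot_subprop => n m.
by apply: (free_subprop (subprop_preim (quot_mor _) HX)) => ? ? [].
Qed.

Lemma BialgcP_generated (X : family (BialgcP K)) :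
  is_subprop X -> ops_in X (BialgcP_ops K) -> X 1%N 2%N (BialgcP_delta K) ->
  forall n m f, X n m f.
Proof.
move=> HX Xops Xdelta; apply: quot_subprop => n m.
apply: (adjoin_subprop (subprop_preim (quot_mor _) HX)) => ? ?.
  pose F := mor_o (quot_mor (gen_ideal (@Bialg_delta_rel K)))
    (adjoin_old (Bialg K) delta_gen).
  exact: (Bialg_generated (subprop_preim F HX)).
by case.
Qed.

Definition Bialgqcoco_old : mor (fpsP (Bialg K)) (Bialgqcoco K) :=
  mor_o (mor_o (quot_mor (torsion_ideal K)) (quot_mor (qcoco_ideal K)))
    (mor_o (comp_in (hfilt _)) (adjoin_old (fpsP (Bialg K)) delta_gen)).

Lemma Bialgqcoco_opsE :
  Bialgqcoco_ops K = map_ops Bialgqcoco_old (fps_ops (Bialg_ops K)).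
Proof. by []. Qed.

Lemma coalg_axioms_Bialgqcoco : coalg_axioms (Bialgqcoco_ops K).
Proof.
rewrite Bialgqcoco_opsE; apply: coalg_axioms_map.
exact/coalg_axioms_fps/coalg_axioms_Bialg.
Qed.

(** Modulo [h], the completed adjunction reduces to the algebraic one and a series over [Bialg] to
    its constant term. So containing all multiples of [h] makes up for the completions. *)
Lemma Bialgqcoco_generated (X : family (Bialgqcoco K)) :
  is_subprop X -> (forall n m f, X n m (hbar K *: f)) ->
  ops_in X (Bialgqcoco_ops K) -> X 1%N 2%N (Bialgqcoco_delta K) ->
  forall n m f, X n m f.
Proof.
move=> HX Xh Xops Xdelta.
have XD n m f g : X n m f -> X n m (f + hbar K *: g).
  by move=> Xf; rewrite -[f]scale1r; apply: (subprop_lin HX).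
pose F := mor_o (mor_o (quot_mor (torsion_ideal K)) (quot_mor (qcoco_ideal K)))
  (comp_in (hfilt (adjoin (fpsP (Bialg K)) delta_gen))).
suff XF n m a : X n m (F n m a).
  apply: quot_subprop => n m; elim/quot_mor_ind => f.
  have [a [y ->]] := hcompletion_approx f; rewrite !(morD, morZ).
  by apply: XD; exact: XF.
move: n m a.
apply: (adjoin_subprop (subprop_preim F HX)) => n m; last by case.
move=> f.
rewrite [f]fps_decomp !(morD, morZ); apply: (XD).
suff XY n' m' (g : Bialg K n' m') :
    X n' m' (Bialgqcoco_old n' m' (fps_cst g)) by exact: XY.
move: n' m' g.
pose Y : family (Bialg K) := fun n m f =>
  X n m (Bialgqcoco_old n m (fps_cst f)).
apply: (@Bialg_generated Y) => //; have HY := subprop_preim Bialgqcoco_old HX.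
split.
- move=> p q; rewrite /Y; have -> : fps_cst 0 = 0 :> fpsP (Bialg K) p q.
    by apply: funext => i; rewrite /fps_cst /fps_mono if_same.
  exact: (subprop0 HY).
- move=> p q a g g' Yg Yg'; rewrite /Y.
  have -> : fps_cst (a *: g + g')
      = (fps_cst a : fps K) *: (fps_cst g : fpsP (Bialg K) p q) + fps_cst g'.
    apply: funext => i; rewrite fps_addE fps_cst_scale /fps_cst /fps_mono.
    by case: eqP; rewrite ?scaler0 ?addr0.
  exact: (subprop_lin HY).
- by move=> p s; exact: (subprop_perm HY).
- move=> p q l g g' Yg Yg'; rewrite /Y fps_cst_comp.
  exact: (subprop_comp HY).
- move=> p q p' q' g g' Yg Yg'; rewrite /Y fps_cst_tens.
  exact: (subprop_tens HY).
Qed.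

End Generation.

Section ModhClass.
Variables (K : comNzRingType) (P : prop (fps K)).

Lemma modh_classP n m (f g : P n m) :
  modh_class f = modh_class g <-> exists y, f = g + hbar K *: y.
Proof.
rewrite /modh_class quot_morP; split=> [[y e]|[y ->]].
  by exists y; rewrite -[hbar K]expr1 -e addrC subrK.
by exists y; rewrite addrC addKr.
Qed.

Lemma modh_class_eq0 n m (f : P n m) :
  modh_class f = 0 <-> exists y, f = hbar K *: y.
Proof.
rewrite -[0]/(modh_class (0 : P n m)).
by rewrite modh_classP; split=> -[y ->]; exists y; rewrite add0r.
Qed.

Lemma modh_class_comp n m l (f : P m l) (g : P n m) :
  modh_class (f \oo g) = modh_class f \oo modh_class g.
Proof. exact: (mor_comp (quot_mor (hideal P 1))). Qed.

Lemma modh_class_tens n m n' m' (f : P n m) (g : P n' m') :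
  modh_class (f \ox g) = modh_class f \ox modh_class g.
Proof. exact: (mor_tens (quot_mor (hideal P 1))). Qed.

Lemma modh_classD n m (f g : P n m) :
  modh_class (f + g) = modh_class f + modh_class g.
Proof. exact: (morD (quot_mor (hideal P 1))). Qed.

Lemma modh_classB n m (f g : P n m) :
  modh_class (f - g) = modh_class f - modh_class g.
Proof. exact: (morB (quot_mor (hideal P 1))). Qed.

Lemma modh_class_lin n m (c : fps K) (f g : P n m) :
  modh_class (c *: f + g) = c 0%N *: modh_class f + modh_class g.
Proof.
transitivity (modh_class ((fps_cst (c 0%N) : fps K) *: f + g)); last first.
  exact: (mor_lin (quot_mor (hideal P 1))).
(* Viewing [K] as the module [K^o] makes the decomposition of series available for the scalar
   [c]. *)
apply/modh_classP; exists ((fps_shift (c : fps K^o) : fps K) *: f).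
rewrite {1}(_ : c = fps_cst (c 0%N) + hbar K * fps_shift (c : fps K^o)).
  by rewrite scalerDl scalerA addrAC.
exact: (fps_decomp (c : fps K^o)).
Qed.

End ModhClass.

Lemma morN (R : comNzRingType) (P P' : preprop R) (F : mor P P')
    n m (f : P n m) :
  F n m (- f) = - F n m f.
Proof. by rewrite -!scaleN1r morZ. Qed.

Lemma scaler_regroup (R : pzRingType) (V : lmodType R) (c : R) (y x e t u : V) :
  y - c *: (x + (t + u)) = y - c *: (e + t) - c *: (x - e) - c *: u.
Proof.
rewrite -!addrA -!opprD -!scalerDr; congr (y - c *: _).
by rewrite addrACA subrKC.
Qed.

(** * The correspondence induced by [SC] and the density of its image *)

Section Semiclassical.
Variables (K : comNzRingType) (SC : mor (UEcP K) (modh (QUE K))).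
Hypothesis hSC : is_semiclassical SC.
Local Notation h := (hbar K).
Local Notation A := (BialgcP K).
Local Notation M := (Bialgqcoco K).
Local Notation inA := (comp_in (J_filt K)).
Local Notation inM := (comp_in (K_filt K)).

(* This relation replaces a map BialgcP -> Bialgqcoco / (h), whose existence *)
(* would require checking the co-Poisson relations in Bialgqcoco / (h).     *)
Definition sc_rel n m (a : A n m) (x : M n m) : Prop :=
  SC n m (inA n m a) = modh_class (inM n m x).

Lemma sc_rel_lin n m (c : fps K) (a a' : A n m) (x x' : M n m) :
  sc_rel a x -> sc_rel a' x' -> sc_rel (c 0%N *: a + a') (c *: x + x').
Proof.
move=> e e'; rewrite /sc_rel !mor_lin.
by rewrite modh_class_lin e e'.
Qed.

Lemma sc_rel0 n m : sc_rel (0 : A n m) (0 : M n m).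
Proof. by rewrite /sc_rel !mor0. Qed.

Lemma sc_relD n m (a a' : A n m) (x x' : M n m) :
  sc_rel a x -> sc_rel a' x' -> sc_rel (a + a') (x + x').
Proof. by move=> e e'; have := sc_rel_lin 1 e e'; rewrite !scale1r. Qed.

Lemma sc_relB n m (a a' : A n m) (x x' : M n m) :
  sc_rel a x -> sc_rel a' x' -> sc_rel (a - a') (x - x').
Proof.
rewrite /sc_rel => e e'.
by rewrite !morB modh_classB e e'.
Qed.

Lemma sc_rel_hbar n m (x : M n m) : sc_rel (0 : A n m) (h *: x).
Proof.
rewrite /sc_rel !mor0; apply/esym/modh_class_eq0.
by exists (inM n m x); rewrite (morZ inM).
Qed.

Lemma sc_rel_perm n (s : 'S_n) : sc_rel (pperm A s) (pperm M s).
Proof. by rewrite /sc_rel !mor_perm. Qed.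

Lemma sc_rel_comp n m l (a : A m l) (a' : A n m) (x : M m l) (x' : M n m) :
  sc_rel a x -> sc_rel a' x' -> sc_rel (a \oo a') (x \oo x').
Proof.
move=> e e'; rewrite /sc_rel !mor_comp.
by rewrite modh_class_comp e e'.
Qed.

Lemma sc_rel_tens n m n' m' (a : A n m) (a' : A n' m')
    (x : M n m) (x' : M n' m') :
  sc_rel a x -> sc_rel a' x' -> sc_rel (a \ox a') (x \ox x').
Proof.
move=> e e'; rewrite /sc_rel !mor_tens.
by rewrite modh_class_tens e e'.
Qed.

Lemma sc_rel_ops :
  [/\ sc_rel (bmul (BialgcP_ops K)) (bmul (Bialgqcoco_ops K)),
      sc_rel (bcomul (BialgcP_ops K)) (bcomul (Bialgqcoco_ops K)),
      sc_rel (bunit (BialgcP_ops K)) (bunit (Bialgqcoco_ops K))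
    & sc_rel (bcounit (BialgcP_ops K)) (bcounit (Bialgqcoco_ops K))].
Proof.
have e := sc_ops hSC; split.
- exact: (congr1 (fun b : bialg_ops (modh (QUE K)) => bmul b) e).
- exact: (congr1 (fun b : bialg_ops (modh (QUE K)) => bcomul b) e).
- exact: (congr1 (fun b : bialg_ops (modh (QUE K)) => bunit b) e).
- exact: (congr1 (fun b : bialg_ops (modh (QUE K)) => bcounit b) e).
Qed.

Lemma sc_rel_conil p :
  sc_rel (conil (BialgcP_ops K) p) (conil (Bialgqcoco_ops K) p).
Proof.
have [_ rD re rc] := sc_rel_ops.
elim: p => [|p IH]; first by rewrite !conil0.
rewrite !conilS.
have rpi := sc_relB (sc_rel_perm (1%g : 'S_1)) (sc_rel_comp re rc).
exact: sc_rel_comp (sc_rel_tens rpi IH) rD.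
Qed.

(** The elements with a partner form a subprop containing the generators, and all multiples of [h],
    which are related to 0. *)
Lemma sc_rel_lift n m (x : M n m) : exists a, sc_rel a x.
Proof.
pose X : family M := fun n m x => exists a, sc_rel a x.
have [rm rD re rc] := sc_rel_ops.
apply: (@Bialgqcoco_generated K X).
- split.
  + by move=> p q; exists 0; exact: sc_rel0.
  + move=> p q c f g [a ea] [a' ea']; exists (c 0%N *: a + a').
    exact: sc_rel_lin.
  + by move=> p s; exists (pperm A s); exact: sc_rel_perm.
  + by move=> p q l f g [a ea] [a' ea']; exists (a \oo a'); exact: sc_rel_comp.
  + move=> p q p' q' f g [a ea] [a' ea']; exists (a \ox a').
    exact: sc_rel_tens.
- by move=> p q f; exists 0; exact: sc_rel_hbar.
- by split; [exists (bmul (BialgcP_ops K))|exists (bcomul (BialgcP_ops K))|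
    exists (bunit (BialgcP_ops K))|exists (bcounit (BialgcP_ops K))].
- by exists (BialgcP_delta K); exact: sc_delta hSC.
Qed.

Lemma sc_rel_image n m (a : A n m) : exists x, sc_rel a x.
Proof.
pose Y : family A := fun n m a => exists x, sc_rel a x.
have [rm rD re rc] := sc_rel_ops.
apply: (@BialgcP_generated K Y).
- split.
  + by move=> p q; exists 0; exact: sc_rel0.
  + move=> p q c f g [a' ea] [b eb]; exists ((fps_cst c : fps K) *: a' + b).
    rewrite -[c *: f]/((fps_cst c : fps K) 0%N *: f); exact: sc_rel_lin.
  + by move=> p s; exists (pperm M s); exact: sc_rel_perm.
  + by move=> p q l f g [x ex] [y ey]; exists (x \oo y); exact: sc_rel_comp.
  + by move=> p q p' q' f g [x ex] [y ey]; exists (x \ox y); exact: sc_rel_tens.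
- by split; [exists (bmul (Bialgqcoco_ops K))|
    exists (bcomul (Bialgqcoco_ops K))|
    exists (bunit (Bialgqcoco_ops K))|exists (bcounit (Bialgqcoco_ops K))].
- by exists (Bialgqcoco_delta K); exact: sc_delta hSC.
Qed.

Lemma K_ideal_conil k p :
  (k <= p)%N -> K_ideal K k _ _ (conil (Bialgqcoco_ops K) p).
Proof. by move=> kp I _ [_]; apply; exact: Conil. Qed.

Lemma J_ideal_conil k p :
  (k <= p)%N -> J_ideal K k _ _ (conil (BialgcP_ops K) p).
Proof. by move=> kp I _; apply; exact: Conil. Qed.

Lemma sc_rel_J_ideal k n m (a : A n m) :
  J_ideal K k _ _ a -> exists2 x, K_ideal K k _ _ x & sc_rel a x.
Proof.
have HK := idealP (K_ideal K k).
pose I : family A := fun n m a => exists2 x, K_ideal K k _ _ x & sc_rel a x.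
move/(_ I); apply; last first.
  by move=> _ _ _ [p kp]; exists (conil (Bialgqcoco_ops K) p);
    [exact: K_ideal_conil|exact: sc_rel_conil].
split.
- by move=> p q; exists 0; [exact: (ideal0 HK)|exact: sc_rel0].
- move=> p q c f g [x Kx ex] [y Ky ey].
  exists ((fps_cst c : fps K) *: x + y); first exact: (idealL HK).
  rewrite -[c *: f]/((fps_cst c : fps K) 0%N *: f); exact: sc_rel_lin.
- move=> p q l f g [y Ky ey]; have [x ex] := sc_rel_image f.
  by exists (x \oo y); [exact: (ideal_compl HK)|exact: sc_rel_comp].
- move=> p q l f g [x Kx ex]; have [y ey] := sc_rel_image g.
  by exists (x \oo y); [exact: (ideal_compr HK)|exact: sc_rel_comp].
- move=> p q p' q' f g [y Ky ey]; have [x ex] := sc_rel_image f.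
  by exists (x \ox y); [exact: (ideal_tensl HK)|exact: sc_rel_tens].
- move=> p q p' q' f g [x Kx ex]; have [y ey] := sc_rel_image g.
  by exists (x \ox y); [exact: (ideal_tensr HK)|exact: sc_rel_tens].
Qed.

(** The family of elements with a partner in J_k is an ideal by [sc_rel_lift]. It is also h-adically
    closed: approximation to first order suffices, since multiples of [h] are related to 0. *)
Lemma sc_rel_K_ideal k n m (x : M n m) :
  K_ideal K k _ _ x -> exists2 a, J_ideal K k _ _ a & sc_rel a x.
Proof.
have HJ := idealP (J_ideal K k).
pose I : family M := fun n m x => exists2 a, J_ideal K k _ _ a & sc_rel a x.
move/(_ I); apply; last first.
  split; last first.
    by move=> _ _ _ [p kp]; exists (conil (BialgcP_ops K) p);
      [exact: J_ideal_conil|exact: sc_rel_conil].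
  move=> p q f /(_ 1%N) [g [[a Ja ea] [y ey]]]; exists a => //.
  rewrite -(subrK g f) addrC ey expr1 -[a]addr0.
  exact: sc_relD ea (sc_rel_hbar y).
split.
- by move=> p q; exists 0; [exact: (ideal0 HJ)|exact: sc_rel0].
- move=> p q c f g [a Ja ea] [b Jb eb].
  by exists (c 0%N *: a + b); [exact: (idealL HJ)|exact: sc_rel_lin].
- move=> p q l f g [b Jb eb]; have [a ea] := sc_rel_lift f.
  by exists (a \oo b); [exact: (ideal_compl HJ)|exact: sc_rel_comp].
- move=> p q l f g [a Ja ea]; have [b eb] := sc_rel_lift g.
  by exists (a \oo b); [exact: (ideal_compr HJ)|exact: sc_rel_comp].
- move=> p q p' q' f g [b Jb eb]; have [a ea] := sc_rel_lift f.
  by exists (a \ox b); [exact: (ideal_tensl HJ)|exact: sc_rel_tens].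
- move=> p q p' q' f g [a Ja ea]; have [b eb] := sc_rel_lift g.
  by exists (a \ox b); [exact: (ideal_tensr HJ)|exact: sc_rel_tens].
Qed.

Lemma K_ideal_closed k : hclosed (K_ideal K k).
Proof. exact: gen_hideal_closed. Qed.

Lemma Bialgqcoco_hcomplete n m : hcomplete (M n m).
Proof. by do 2!apply: quotP_hcomplete; exact: hcompletion_hcomplete. Qed.

Lemma QUE_hcomplete n m : hcomplete (QUE K n m).
Proof.
apply: completion_hcomplete => k; first exact: K_ideal_closed.
exact/quotP_hcomplete/Bialgqcoco_hcomplete.
Qed.

Lemma QUE_hseparated n m : hseparated (QUE K n m).
Proof. by apply: completion_hseparated => k; exact: K_ideal_closed. Qed.

(* The image of SC is dense for the topology of QUE defined by (K_k). *)
Lemma sc_approx n m (x : QUE K n m) :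
  exists f, forall k, exists g : QUE K n m,
    comp_proj (K_filt K) k n m g = 0 /\ SC n m f = modh_class (x - g).
Proof.
have [u [ux uK]] := comp_reps x.
have [a0 ea0] := sc_rel_lift (u 0%N).
have dP k : exists d, J_ideal K k _ _ d /\ sc_rel d (u k.+1 - u k).
  by have [d] := sc_rel_K_ideal (uK k); exists d.
have [d {}dP] := choice dP.
(* Arbitrary lifts of the [u k] need not converge; lifting the increments into J_k makes the [a k] a
   Cauchy sequence. *)
pose a k := a0 + \sum_(i < k) d i.
have aS k : a k.+1 = a k + d k by rewrite /a big_ord_recr addrA.
have aP k : sc_rel (a k) (u k).
  elim: k => [|k IH]; first by rewrite /a big_ord0 addr0.
  rewrite aS -(subrK (u k) (u k.+1)) [_ - _ + _]addrC.
  exact: sc_relD IH (proj2 (dP k)).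
have [|f fa] := @comp_lim K A (J_filt K) n m a.
  by move=> k; rewrite aS [a k + _]addrC addrK; case: (dP k).
exists f => k; have [l lP] := sc_cont hSC k.
(* At least l, so that continuity of [SC] applies, and at least k, so that [u N] is close to [x]. *)
pose N := (k + l)%N.
have [|g [g0 eg]] := lP n m (f - inA n m (a N)).
  apply: (@comp_proj0_le _ _ (J_filt K) l N); first exact: leq_addl.
  by rewrite morB fa subrr.
exists (x - inM n m (u N) - g); split.
  rewrite morB g0 subr0; apply: (@comp_proj0_le _ _ (K_filt K) k N).
    exact: leq_addr.
  rewrite morB (ux N); exact: subrr.
have -> : x - (x - inM n m (u N) - g) = g + inM n m (u N).
  by rewrite -[x - _ - g]addrA -opprD subKr addrC.
rewrite -(subrK (inA n m (a N)) f) morD eg modh_classD; congr (_ + _).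
exact: aP.
Qed.

End Semiclassical.

(** * Control of h-torsion by [Q], and bijectivity of [Q] *)

Section Quantization.
Variables (K : comNzRingType) (SC : mor (UEcP K) (modh (QUE K))).
Hypothesis hSC : is_semiclassical SC.
Variable Q : mor (QUE K) (fpsP (UEcP K)).
Hypothesis hQ : is_quantization SC Q.
Local Notation h := (hbar K).
Local Notation A := (BialgcP K).
Local Notation M := (Bialgqcoco K).
Local Notation inA := (comp_in (J_filt K)).
Local Notation inM := (comp_in (K_filt K)).
Local Notation projA := (comp_proj (J_filt K)).
Local Notation projM := (comp_proj (K_filt K)).

Lemma quant_const n m (f : UEcP K n m) (x : QUE K n m) :
  SC n m f = modh_class x -> (Q n m x : fps (UEcP K n m)) 0%N = f.
Proof.
move=> e; have := congr1 (fun F : mor (UEcP K) (UEcP K) => F n m f) hQ.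
by rewrite !mor_oE e modh_mor_class [LHS]ev0_class.
Qed.

(* [f] is sent into h^N by UEcP[[h]] -> (BialgcP / J_s)[[h]]. *)
Definition hsmall N s n m (f : fpsP (UEcP K) n m) : Prop :=
  forall i, (i < N)%N -> projA s n m ((f : fps (UEcP K n m)) i) = 0.

(** A term of the Cauchy product in degree below a + b has its left index below a or its right index
    below b. *)
Lemma hsmall_comp a b s n m l (f : fpsP (UEcP K) m l) (g : fpsP (UEcP K) n m) :
  hsmall a s f -> hsmall b s g -> hsmall (a + b) s (f \oo g).
Proof.
move=> f0 g0 i iab; pose B x := projA s n l x = 0; rewrite -/(B _).
apply: (big_ind B) => [|x y Bx By|j _].
- exact: mor0.
- by rewrite /B morD Bx By addr0.
rewrite /B mor_comp; have [ja|aj] := ltnP j a; first by rewrite f0 ?pcomp0l.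
rewrite (g0 (i - j)%N) ?pcomp0r //.
by rewrite ltn_subLR ?(leq_trans iab) ?leq_add2r // -ltnS.
Qed.

Lemma hsmall_tens a b s n m n' m'
    (f : fpsP (UEcP K) n m) (g : fpsP (UEcP K) n' m') :
  hsmall a s f -> hsmall b s g -> hsmall (a + b) s (f \ox g).
Proof.
move=> f0 g0 i iab; pose B x := projA s (n + n')%N (m + m')%N x = 0.
rewrite -/(B _); apply: (big_ind B) => [|x y Bx By|j _].
- exact: mor0.
- by rewrite /B morD Bx By addr0.
rewrite /B mor_tens; have [ja|aj] := ltnP j a; first by rewrite f0 ?ptens0l.
rewrite (g0 (i - j)%N) ?ptens0r //.
by rewrite ltn_subLR ?(leq_trans iab) ?leq_add2r // -ltnS.
Qed.

Lemma hsmall_lin N s n m (c : fps K) (f g : fpsP (UEcP K) n m) :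
  hsmall N s f -> hsmall N s g -> hsmall N s (c *: f + g).
Proof.
move=> f0 g0 i iN; rewrite [X in projA _ _ _ X]fps_addE morD g0 // addr0.
pose B x := projA s n m x = 0; rewrite -/(B _).
apply: (big_ind B) => [|x y Bx By|j _].
- exact: mor0.
- by rewrite /B morD Bx By addr0.
by rewrite /B morZ f0 ?scaler0 // (leq_ltn_trans _ iN) // leq_subr.
Qed.

(** This is a closed ideal, so that K_l lies in it as soon as the generators of K_l do. *)
Definition quant_small N s : family M :=
  fun n m x => hsmall N s (Q n m (inM n m x)).

Lemma quant_small_ideal N s : is_ideal (quant_small N s).
Proof.
have small0 n m (f : fpsP (UEcP K) n m) : hsmall 0 s f by [].
rewrite /quant_small; split.
- by move=> n m i iN; rewrite !mor0.
- by move=> n m a f g Wf Wg; rewrite !mor_lin; exact: hsmall_lin.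
- by move=> n m l f g Wg; rewrite !mor_comp; exact: (@hsmall_comp 0 N).
- move=> n m l f g Wf; rewrite !mor_comp -(addn0 N).
  exact: hsmall_comp.
- by move=> n m n' m' f g Wg; rewrite !mor_tens; exact: (@hsmall_tens 0 N).
- move=> n m n' m' f g Wf; rewrite !mor_tens -(addn0 N).
  exact: hsmall_tens.
Qed.

Lemma quant_small_closed N s : hclosed (quant_small N s).
Proof.
move=> n m f /(_ N) [g [Wg [y e]]] i iN.
rewrite -(subrK g f) e !(morD, morZ) hbarX_scale_lt // mor0 add0r.
exact: Wg.
Qed.

(* Delta^(p) can be cut into N blocks of size at least s, each of which has  *)
(* its image under Q divisible by h in (BialgcP / J_s)[[h]].                *)
Lemma quant_small_conil N s p :
  (N * s <= p)%N -> quant_small N s (conil (Bialgqcoco_ops K) p).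
Proof.
elim: N p => [|N IH] p; first by move=> _ i.
rewrite mulSn => Nsp; have sp := leq_trans (leq_addr _ _) Nsp.
have [DA Cl] := coalg_axioms_Bialgqcoco K.
rewrite -(subnKC sp) (conilD DA Cl) /quant_small !mor_comp !mor_tens.
rewrite -(addn0 N.+1); apply: hsmall_comp; last by move=> i; rewrite ltn0.
rewrite -(add1n N); apply: hsmall_tens; last by apply: IH; rewrite leq_subRL.
move=> [|//] _; rewrite (quant_const (sc_rel_conil hSC s)).
by apply/comp_in_proj0; exact: J_ideal_conil.
Qed.

Lemma quant_small_K_ideal N s l n m (x : M n m) :
  (N * s <= l)%N -> K_ideal K l _ _ x -> quant_small N s x.
Proof.
move=> Nsl /(_ _ (quant_small_ideal N s)); apply; split.
  exact: quant_small_closed.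
move=> _ _ _ [p lp]; apply: quant_small_conil; exact: leq_trans lp.
Qed.

(** The coefficient of h^N in the image of h^N x under [Q] is the constant term of the image of x,
    that is, a lift of x through [SC]. It vanishes modulo J_s, so x has the same class modulo [h] as
    an element of K_s. *)
Lemma K_ideal_hdiv N s l n m (x : M n m) :
  (N.+1 * s <= l)%N -> K_ideal K l _ _ (h ^+ N *: x) ->
  exists2 x', K_ideal K s _ _ x' & exists y, x = x' + h *: y.
Proof.
move=> Nsl Kx; have [a ax] := sc_rel_lift hSC x.
have Ja : J_ideal K s _ _ a.
  have := quant_small_K_ideal Nsl Kx; move/(_ N (ltnSn N)).
  rewrite !morZ -{2}(addn0 N) hbarX_scale (quant_const ax) => a0.
  exact/(@comp_in_proj0 _ _ (J_filt K)).
have [x' Kx' ax'] := sc_rel_J_ideal hSC Ja.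
have [z ez] : exists z, inM n m x = inM n m x' + h *: z.
  by apply/modh_classP; rewrite -ax -ax'.
(* [z] lives only in [QUE]; replacing it by an element of [Bialgqcoco] costs an element of K_s. *)
have [y ey] := comp_proj_rep s z.
have Kd : K_ideal K s _ _ (x - (x' + h *: y)).
  apply/(@comp_in_proj0 _ _ (K_filt K)).
  rewrite !(morB, morD, morZ) ez !(morD, morZ) ey; exact: subrr.
exists (x' + (x - (x' + h *: y))).
  exact: (smemD (S := ideal_submod (K_ideal K _) n m)).
by exists y; rewrite addrC addrCA addrA subrKC.
Qed.

Lemma K_ideal_hbar N s :
  exists l, forall n m (x : M n m), K_ideal K l _ _ (h *: x) ->
  exists2 x', K_ideal K s _ _ x' & exists y, x = x' + h ^+ N *: y.
Proof.
elim: N s => [|N IH] s.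
  exists 0%N => n m x _; exists 0; first exact: (ideal0 (idealP (K_ideal K s))).
  by exists x; rewrite add0r scale1r.
(* The summand s puts [x1] in K_s; the other one puts h^(N+1) y, which is h (x - x1), deep enough
   for [K_ideal_hdiv] with exponent N + 1. *)
have [l lP] := IH (s + N.+2 * s)%N; exists (l + (s + N.+2 * s))%N => n m x Kx.
have [|x1 Kx1 [y ey]] := lP n m x.
  exact: (@filt_le _ _ (K_filt K) _ _ _ _ _ (leq_addr _ _) Kx).
have [||x2 Kx2 [z ez]] := @K_ideal_hdiv N.+1 s (s + N.+2 * s)%N n m y.
- exact: leq_addl.
- rewrite exprS -scalerA (_ : h ^+ N *: y = x - x1); last first.
    by rewrite ey addrC addKr.
  rewrite scalerBr; apply: (smemD (S := ideal_submod (K_ideal K _) n m)).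
    exact: (@filt_le _ _ (K_filt K) _ _ _ _ _ (leq_addl _ _) Kx).
  apply: (smemN (S := ideal_submod (K_ideal K _) n m)).
  exact: (smemZ (S := ideal_submod (K_ideal K _) n m)).
exists (x1 + h ^+ N *: x2).
  apply: (smemD (S := ideal_submod (K_ideal K _) n m)).
    exact: (@filt_le _ _ (K_filt K) _ _ _ _ _ (leq_addr _ _) Kx1).
  exact: (smemZ (S := ideal_submod (K_ideal K _) n m)).
exists z; rewrite ey ez scalerDr scalerA -exprSr; exact: addrA.
Qed.

(** The quotients [w k] of [y] by [h] modulo K_k need not be compatible. Along a subsequence they
    change by an element of K_N plus a multiple of h^N, hence converge for the two topologies
    together. *)
Lemma hQUE_closed n m (y : QUE K n m) :
  (forall k, exists g z, projM k n m g = 0 /\ y = g + h *: z) ->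
  exists z, y = h *: z.
Proof.
move=> yP.
have wP k : exists w, projM k n m (y - h *: inM n m w) = 0.
  have [g [z [g0 ey]]] := yP k; have [w ew] := comp_proj_rep k z.
  exists w; rewrite ey morB morD !morZ g0 add0r ew; exact: subrr.
have [w {}wP] := choice wP.
have [l0 l0P] := choice (fun N => K_ideal_hbar N N).
(* Nondecreasing, and at least both N and [l0 N]. *)
pose l N := (N + \sum_(i < N.+1) l0 i)%N.
have lS N : (l N <= l N.+1)%N.
  by rewrite leq_add // [leqRHS]big_ord_recr leq_addr.
have l0l N : (l0 N <= l N)%N.
  by rewrite /l big_ord_recr /= addnA leq_addl.
pose v N := w (l N).
have vP N : exists eb : M n m * M n m,
    K_ideal K N n m eb.1 /\ v N.+1 = v N + (eb.1 + h ^+ N *: eb.2).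
  have [|e Ke [b eb]] := l0P N n m (v N.+1 - v N).
    apply: (@filt_le _ _ (K_filt K) _ _ _ _ _ (l0l N)).
    apply/(@comp_in_proj0 _ _ (K_filt K)).
    have -> : inM n m (h *: (v N.+1 - v N)) =
        (y - h *: inM n m (v N)) - (y - h *: inM n m (v N.+1)).
      rewrite (morZ inM) (morB inM) scalerBr opprB.
      by rewrite [RHS]addrC addrA subrK.
    rewrite morB wP (@comp_proj0_le _ _ (K_filt K) _ _ _ _ _ (lS N)) ?wP //.
    exact: subrr.
  exists (e, b); split; first exact: Ke.
  by rewrite -[v N.+1](subrKC (v N)) eb.
have [eb {}vP] := choice vP.
pose e N := (eb N).1; pose b N := (eb N).2.
(* [E] converges for (K_k) and the series of the h^i [b i] converges h-adically; the quotient sought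
   is the sum of the two limits. *)
pose E k := v 0%N + \sum_(i < k) e i.
have ES k : E k.+1 = E k + e k by rewrite /E big_ord_recr addrA.
have vE k : v k = E k + \sum_(i < k) h ^+ i *: b i.
  elim: k => [|k IH]; first by rewrite /E !big_ord0 !addr0.
  rewrite (proj2 (vP k)) IH ES big_ord_recr; exact: addrACA.
have [|x xE] := @comp_lim _ _ (K_filt K) n m E.
  by move=> k; rewrite ES [E k + _]addrC addrK; case: (vP k).
have [s sP] := @QUE_hcomplete K n m (fun k => inM n m (b k)).
exists (x + s 0%N); apply/eqP; rewrite -subr_eq0; apply/eqP.
apply: comp_ext => k; rewrite mor0.
apply: (quotP_hseparated (@K_ideal_closed K k)) => j.
(* With N at least k, the errors of [v N] and [E N] vanish modulo K_k; with N at least j, the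
   remaining tail is divisible by h^j. *)
pose N := (k + j)%N; have kN : (k <= N)%N by exact: leq_addr.
exists (projM k n m (- (h ^+ k.+1 *: s N))).
have inv : inM n m (v N) = inM n m (E N) + \sum_(i < N) h ^+ i *: inM n m (b i).
  rewrite vE (morD inM) (big_morph (inM n m) (morD inM (m:=m)) (mor0 inM n m)).
  by congr (_ + _); apply: eq_bigr => i _; exact: (morZ inM).
have y0 : projM k n m (y - h *: inM n m (v N)) = 0.
  apply: (@comp_proj0_le _ _ (K_filt K) k (l N)); last exact: wP.
  exact: leq_trans (leq_addr _ _).
have x0 : projM k n m (x - inM n m (E N)) = 0.
  apply: (@comp_proj0_le _ _ (K_filt K) k N); first exact: kN.
  rewrite morB xE; exact: subrr.
rewrite (hsumsX N sP) (scaler_regroup _ _ _ (inM n m (E N))) -inv.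
rewrite morB (morB _ (_ - _) (h *: (x - _))) y0 (morZ _ h (x - _)) x0.
rewrite scaler0 subr0 sub0r -morN -morZ scalerN; congr (projM k n m _).
have hN : h * h ^+ N = h ^+ j * h ^+ k.+1.
  by rewrite -exprS -exprD addnS /N addnC.
by rewrite !scalerA hN.
Qed.

(** Take [f] from [sc_approx]: a representative of its image differs from [y] by an element of the
    closure of h QUE, which is h QUE. *)
Lemma SC_surj n m (y : QUE K n m) : exists f, SC n m f = modh_class y.
Proof.
have [f fP] := sc_approx hSC y; exists f.
have [x ex] : exists x, SC n m f = modh_class x.
  by have [g [_ ->]] := fP 0%N; eexists.
rewrite ex; apply/modh_classP.
have [|z ez] := @hQUE_closed n m (x - y); last first.
  by exists z; rewrite -ez subrKC.
move=> k; have [g [g0 eg]] := fP k.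
have /modh_classP[z ez] : modh_class x = modh_class (y - g) by rewrite -ex.
exists (- g), z; rewrite morN g0 oppr0; split=> //.
by rewrite ez -[y - g + _]addrA [y + _]addrC addrK.
Qed.

Lemma SC_section : mor_o SC (mor_o (ev0 (UEcP K)) (modh_mor Q)) = mor_id _.
Proof.
apply: mor_ext => n m; elim/modh_ind => x.
have [f fx] := SC_surj x; rewrite -{1}fx.
have := congr1 (fun F : mor (UEcP K) (UEcP K) => F n m f) hQ.
by rewrite !mor_oE => ->; exact: fx.
Qed.

(** Modulo [h], a preimage of a constant term is given by [SC]; conversely, if [SC] sends f to the
    class of v, then f is the constant term of Q v, so v is divisible by [h] when Q v is. *)
Lemma quant_bijective n m : bijective (Q n m).
Proof.
apply: (@hadic_bijective K (QUE K n m) (fpsP (UEcP K) n m) (Q n m)).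
- exact: mor_lin.
- exact: QUE_hcomplete.
- exact: QUE_hseparated.
- exact: (@fps_hseparated K (UEcP K n m)).
- exact: (@fps_hbar_eq0 K (UEcP K n m)).
- move=> w; have [x xw] : exists x, SC n m (w 0%N) = modh_class x.
    by elim/modh_ind: (SC n m (w 0%N)) => x; exists x.
  exists x, (fps_shift (w - Q n m x)).
  rewrite -{1}(subrKC (Q n m x) w); congr (_ + _).
  rewrite [LHS]fps_decomp (_ : (w - Q n m x) 0%N = 0).
    rewrite (_ : fps_cst 0 = 0) ?add0r //.
    by apply: funext => i; rewrite /fps_cst /fps_mono if_same.
  by rewrite [LHS]fps_addE -{1}(quant_const xw); exact: subrr.
- move=> v w Qv; apply/modh_class_eq0; have [f fv] := SC_surj v.
  rewrite -fv -[f](quant_const fv) Qv hbar_scale0; exact: mor0.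
Qed.

End Quantization.

Lemma bijective_is_iso (R : comNzRingType) (P P' : preprop R) (F : mor P P') :
  (forall n m, bijective (F n m)) -> is_iso F.
Proof.
move=> bF; have injF n m : injective (F n m) := bij_inj (bF n m).
have surjF n m y : exists x, F n m x = y.
  by case: (bF n m) => g _ gK; exists (g y).
pose G n m y := sval (cid (surjF n m y)).
have GK n m y : F n m (G n m y) = y := svalP (cid (surjF n m y)).
unshelve eexists.
  exists G.
  - by move=> n m a f g; apply: injF; rewrite mor_lin !GK.
  - by move=> n s; apply: injF; rewrite mor_perm GK.
  - by move=> n m l f g; apply: injF; rewrite mor_comp !GK.
  - by move=> n m n' m' f g; apply: injF; rewrite mor_tens !GK.
split; apply: mor_ext => n m f; last exact: GK.
apply: (injF); exact: GK.
Qed.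

Lemma ev0_inj (K : comNzRingType) (P : prop K) n m : injective (ev0 P n m).
Proof.
elim/modh_ind => f; elim/modh_ind => g e; apply/modh_classP.
have {}e : f 0%N = g 0%N.
  by rewrite -[f 0%N]ev0_class -[g 0%N]ev0_class; exact: e.
exists (fps_shift (f - g)); rewrite -{1}(subrKC g f); congr (_ + _).
rewrite [LHS]fps_decomp (_ : (f - g) 0%N = 0).
  rewrite (_ : fps_cst 0 = 0) ?add0r //.
  by apply: funext => i; rewrite /fps_cst /fps_mono if_same.
by rewrite [LHS]fps_addE e; exact: subrr.
Qed.

(** * The two torsor structures *)

Section Torsors.
Variables (K : comNzRingType) (SC : mor (UEcP K) (modh (QUE K))).
Hypothesis hSC : is_semiclassical SC.

Lemma quant_iso (Q : mor (QUE K) (fpsP (UEcP K))) :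
  is_quantization SC Q -> is_iso Q.
Proof.
move=> hQ; apply: bijective_is_iso => n m; exact: (quant_bijective hSC hQ).
Qed.

Lemma quantization_ext (Q Q' : quantization SC) :
  quant_mor Q = quant_mor Q' -> Q = Q'.
Proof.
case: Q Q' => [Q hQ] [Q' hQ'] /= e; case: _ / e hQ' => hQ'.
by congr Quantization; exact: Prop_irrelevance.
Qed.

(** A left inverse of [SC], from [Q], equals a right inverse, from [Q']. *)
Lemma quant_modh_uniq (Q Q' : quantization SC) :
  mor_o (ev0 (UEcP K)) (modh_mor Q) = mor_o (ev0 (UEcP K)) (modh_mor Q').
Proof.
rewrite -[LHS]mor_o_idr -(SC_section hSC (quantP Q')) mor_oA.
by rewrite (quantP Q) mor_o_idl.
Qed.

(** The element is Q^-1 Q'. It reduces to the identity because [SC] composed with the reduction of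
    [Q], or of [Q'], is the identity. *)
Lemma quant_ract_uniq (Q Q' : quantization SC) : exists! g, quant_ract Q g = Q'.
Proof.
have [G [GQ QG]] := quant_iso (quantP Q).
have [G' [GQ' QG']] := quant_iso (quantP Q').
have iso : is_iso (mor_o G Q').
  exists (mor_o G' Q); split.
    by rewrite mor_oA -(mor_oA G') QG mor_o_idr.
  by rewrite mor_oA -(mor_oA G) QG' mor_o_idr.
have modg : modh_mor (mor_o G Q') = mor_id _.
  have sQ := SC_section hSC (quantP Q).
  have eQ : mor_o Q (mor_o G Q') = Q' by rewrite mor_oA QG mor_o_idl.
  rewrite -[LHS]mor_o_idl -{1}sQ -mor_oA -mor_oA -modh_mor_o.
  by rewrite eQ -(quant_modh_uniq Q).
exists (Aut1 iso modg); split.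
  by apply: quantization_ext; rewrite /= mor_oA QG mor_o_idl.
move=> g /(congr1 (@quant_mor K SC)) gE; apply: aut1_ext.
have {}gE : mor_o Q g = Q' by exact: gE.
change (mor_o G Q' = g).
rewrite -gE mor_oA GQ; exact: mor_o_idl.
Qed.

(** The element is Q' Q^-1; [ev0_inj] turns the equality of reductions after [ev0] into an equality
    modulo [h]. *)
Lemma quant_lact_uniq (Q Q' : quantization SC) : exists! g, quant_lact g Q = Q'.
Proof.
have [G [GQ QG]] := quant_iso (quantP Q).
have [G' [GQ' QG']] := quant_iso (quantP Q').
have iso : is_iso (mor_o Q' G).
  exists (mor_o Q G'); split.
    by rewrite mor_oA -(mor_oA Q) GQ' mor_o_idr.
  by rewrite mor_oA -(mor_oA Q') GQ mor_o_idr.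
have modg : modh_mor (mor_o Q' G) = mor_id _.
  have eQ : modh_mor Q' = modh_mor Q.
    apply: mor_ext => n m f; apply: ev0_inj.
    exact: (congr1 (fun F : mor _ _ => F n m f) (quant_modh_uniq Q' Q)).
  by rewrite modh_mor_o eQ -modh_mor_o QG modh_mor_id.
exists (Aut1 iso modg); split.
  by apply: quantization_ext; rewrite /= -mor_oA GQ mor_o_idr.
move=> g /(congr1 (@quant_mor K SC)) gE; apply: aut1_ext.
have {}gE : mor_o g Q = Q' by exact: gE.
change (mor_o Q' G = g).
rewrite -gE -mor_oA QG; exact: mor_o_idr.
Qed.

End Torsors.

Theorem proposition4p1 (K : fieldType) (charK : [pchar K]%R =i pred0)
    (SC : mor (UEcP K) (modh (QUE K))) (hSC : is_semiclassical SC) :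
  (forall Q : mor (QUE K) (fpsP (UEcP K)), is_quantization SC Q -> is_iso Q) /\
  ((exists Q : mor (QUE K) (fpsP (UEcP K)), is_quantization SC Q) ->
     is_right_torsor (@quant_ract K SC) /\ is_left_torsor (@quant_lact K SC)).
Proof.
split=> [Q|[Q hQ]]; first exact: quant_iso.
split; split; try exact: (inhabits (Quantization hQ)).
- by move=> X; apply: quantization_ext; exact: mor_o_idr.
- by move=> X g k; apply: quantization_ext; exact: esym (mor_oA _ _ _).
- exact: (quant_ract_uniq hSC).
- by move=> X; apply: quantization_ext; exact: mor_o_idl.
- by move=> g k X; apply: quantization_ext; exact: mor_oA.
- exact: (quant_lact_uniq hSC).
Qed.
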